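(* Let $\Bbbk$ be an arbitrary field, $S=\Bbbk[x_1,\dots,x_n]$, let $2\le e_1\le\cdots\le e_n\le\infty$, and let $P=(x_1^{e_1},\dots,x_n^{e_n})$, where $x_i^{\infty}=0$. Let $I\subset S$ be a monomial ideal containing $P$. Then there exists a Borel-plus-$P$ ideal $B$ such that $B$ has the same Hilbert function as $I$, and $b_{i,j}(B)\ge b_{i,j}(I)$ for all $i,j$.
   Context: $S$ is standard graded. The Hilbert function of a graded module $M$ is $d\mapsto\dim_{\Bbbk}M_d$, and $b_{i,j}(M)=\dim_{\Bbbk}\operatorname{Tor}^S_i(\Bbbk,M)_j$. The $e_i$ are integers or $\infty$. A monomial ideal $\hat B$ is Borel if for every monomial $f$ and all $i<j$, $fx_j\in\hat B$ implies $fx_i\in\hat B$. An ideal $B\supseteq P$ is Borel-plus-$P$ if there is a Borel ideal $\hat B$ with $B=\hat B+P$. *)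

(* Defs.v *)
From HB Require Import structures.
From mathcomp Require Import all_boot all_order all_algebra.
From mathcomp Require Import boolp classical_sets.
From mathcomp Require Import mpoly.

Set Implicit Arguments.
Unset Strict Implicit.
Unset Printing Implicit Defensive.

Import GRing.Theory.
Local Open Scope ring_scope.
Local Open Scope classical_set_scope.

(* [is_dim Z W r]: the images of some v_1, ..., v_r in Z form a basis of the
   quotient Z / W, where W <= Z are linear subspaces of V. *)
Definition is_dim (k : fieldType) (V : lmodType k) (Z W : set V) (r : nat) :=
  exists v : 'I_r -> V,
    [/\ forall i, Z (v i),
        forall c : 'I_r -> k, W (\sum_i c i *: v i) -> forall i, c i = 0
      & forall z, Z z -> exists c : 'I_r -> k, W (z - \sum_i c i *: v i)].

(* dim_k (Z / W), with junk value 0 when this is infinite *)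
Definition dimq (k : fieldType) (V : lmodType k) (Z W : set V) : nat :=
  xget 0%N [set r | is_dim Z W r].

Lemma is_dim_leq (k : fieldType) (V : lmodType k) (Z W : set V) (r s : nat) :
  W 0 -> (forall a u v, W u -> W v -> W (a *: u + v)) ->
  is_dim Z W r -> is_dim Z W s -> (r <= s)%N.
Proof.
move=> W0 WD [v [vZ vfree _]] [w [_ _ wspan]].
have /choice[A hA] : forall i, exists c : 'I_s -> k,
    W (v i - \sum_j c j *: w j) by move=> i; exact/wspan/vZ.
pose M := \matrix_(i < r, j < s) A i j.
rewrite leqNgt; apply/negP => ltsr.
have /rowV0Pn[c /sub_kermxP cM] : kermx M != 0.
  rewrite -mxrank_eq0 mxrank_ker subn_eq0 -ltnNge.
  exact: leq_ltn_trans (rank_leq_col M) ltsr.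
case/eqP; apply/rowP => i; rewrite mxE; apply: (vfree (fun i => c 0 i)).
have -> : \sum_i c 0 i *: v i =
    \sum_i c 0 i *: (v i - \sum_j A i j *: w j).
  symmetry; under eq_bigr do rewrite scalerBr scaler_sumr.
  rewrite sumrB exchange_big /= [X in _ - X]big1 ?subr0 // => j _.
  under eq_bigr do rewrite scalerA.
  rewrite -scaler_suml; have := congr1 (fun X : 'rV_s => X 0 j) cM.
  rewrite !mxE; under eq_bigr do rewrite mxE.
  by move->; rewrite scale0r.
by elim/big_ind: _ => // [x y Wx Wy|i' _];
  [rewrite -[x]scale1r; exact: WD | rewrite -[_ *: _]addr0; exact: WD].
Qed.

Lemma dimqE (k : fieldType) (V : lmodType k) (Z W : set V) (r : nat) :
  W 0 -> (forall a u v, W u -> W v -> W (a *: u + v)) ->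
  is_dim Z W r -> dimq Z W = r.
Proof.
move=> W0 WD Zr; apply: xget_unique => // s Zs.
by apply/eqP; rewrite eqn_leq !(is_dim_leq W0 WD Zr, is_dim_leq W0 WD Zs).
Qed.

Definition ideal_gen (R : comNzRingType) (G : set R) : set R :=
  [set f | exists (r : nat) (c g : 'I_r -> R),
     (forall i, G (g i)) /\ f = \sum_i c i * g i].

Definition monomial_ideal (k : fieldType) (n : nat) (J : set {mpoly k[n]}) :=
  exists A : set 'X_{1..n}, J = ideal_gen [set 'X_[m] | m in A].

(* The exponents e_i are in nat + {oo}, encoded as [option nat] with
   [None] standing for oo. *)
Definition le_exp (a b : option nat) : bool :=
  match a, b with
  | _, None => true
  | None, Some _ => false
  | Some a', Some b' => (a' <= b')%N
  end.

Definition pure_power (k : fieldType) (n : nat) (e : 'I_n -> option nat)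
    (i : 'I_n) : {mpoly k[n]} :=
  if e i is Some d then 'X_i ^+ d else 0.

Definition pure_powers_ideal (k : fieldType) (n : nat)
    (e : 'I_n -> option nat) : set {mpoly k[n]} :=
  ideal_gen [set pure_power k e i | i in [set: 'I_n]].

Arguments pure_powers_ideal k {n} e _.

Definition borel (k : fieldType) (n : nat) (J : set {mpoly k[n]}) :=
  monomial_ideal J /\
  forall (m : 'X_{1..n}) (i j : 'I_n), (i < j)%N ->
    J ('X_[m] * 'X_j) -> J ('X_[m] * 'X_i).

Definition borel_plus (k : fieldType) (n : nat) (P B : set {mpoly k[n]}) :=
  P `<=` B /\
  exists Bhat : set {mpoly k[n]},
    borel Bhat /\ B = [set f + g | f in Bhat & g in P].

Definition hilbert (k : fieldType) (n : nat) (J : set {mpoly k[n]}) (d : nat) :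
    nat :=
  dimq [set f | J f /\ f \is d.-homog] [set 0].

(* f lies in the degree j component of S(-d). *)
Definition shift_homog (k : fieldType) (n : nat) (d j : nat)
    (f : {mpoly k[n]}) : bool :=
  if (d <= j)%N then f \is (j - d)%N.-homog else f == 0.

(* The S-linear map S^A -> S^B sending e_a to \sum_b D a b * e_b. *)
Definition free_map (R : comNzRingType) (A B : finType) (D : A -> B -> R)
    (v : {ffun A -> R}) : {ffun B -> R} :=
  [ffun b => \sum_a v a * D a b].

(* The S-linear map S^A -> k = S / (x_1, ..., x_n) sending e_a to eps a. *)
Definition augmentation (k : fieldType) (n : nat) (A : finType) (eps : A -> k)
    (v : {ffun A -> {mpoly k[n]}}) : k :=
  \sum_a (v a)@_0%MM * eps a.

(* Graded free resolutions
     ... -> F_2 -> F_1 -> F_0 -> k -> 0,  F_i = \bigoplus_(a : gen i) S(-gdeg a),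
   of the residue field k, concentrated in degree 0. *)
Record resolution (k : fieldType) (n : nat) := Resolution {
  gen : nat -> finType;
  gdeg : forall i, gen i -> nat;
  diff : forall i, gen i.+1 -> gen i -> {mpoly k[n]};
  aug : gen 0%N -> k;
  diff_homog : forall i a b, shift_homog (@gdeg i b) (gdeg a) (diff a b);
  aug_homog : forall a, aug a != 0 -> gdeg a = 0%N;
  aug_surj : exists v, augmentation (n := n) aug v = 1;
  exact_aug : forall v,
    augmentation aug v = 0 <-> exists w, v = free_map (@diff 0%N) w;
  exact_diff : forall i v,
    free_map (@diff i) v = 0 <-> exists w, v = free_map (@diff i.+1) w }.

Arguments gdeg {k n} r i _.
Arguments diff {k n} r i _ _.

Section Tor.
Variables (k : fieldType) (n : nat) (F : resolution k n).
Variable J : set {mpoly k[n]}.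

(* As F_i is free, F_i \otimes_S J is the submodule
   \bigoplus_(a : gen i) J(-gdeg a) of F_i; this is its component of degree j. *)
Definition tensor_comp (i j : nat) : set {ffun gen F i -> {mpoly k[n]}} :=
  [set v | forall a, J (v a) /\ shift_homog (gdeg F i a) j (v a)].

Definition tor_cycles (i j : nat) : set {ffun gen F i -> {mpoly k[n]}} :=
  match i with
  | 0 => @tensor_comp 0%N j
  | i'.+1 => [set v | @tensor_comp i'.+1 j v /\ free_map (diff F i') v = 0]
  end.

Definition tor_boundaries (i j : nat) : set {ffun gen F i -> {mpoly k[n]}} :=
  [set free_map (diff F i) w | w in @tensor_comp i.+1 j].

(* dim_k Tor_i^S(k, J)_j = dim_k H_i(F \otimes_S J)_j *)
Definition tor_dim (i j : nat) : nat :=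
  dimq (@tor_cycles i j) (@tor_boundaries i j).

End Tor.

Section Koszul.
Variables (k : fieldType) (n : nat).
Local Notation S := {mpoly k[n]}.
Implicit Types (A C : {set 'I_n}) (p q r : 'I_n) (m : 'X_{1..n}).
Implicit Types G : {set 'I_n} -> S.

Definition kgen (i : nat) : finType := {A : {set 'I_n} | #|A| == i}.

Definition kpos q A := #|[pred r in A | (r < q)%N]|.

Definition kdiff (i : nat) (a : kgen i.+1) (c : kgen i) : S :=
  \sum_(q in val a | val a :\ q == val c) (-1) ^+ kpos q (val a) *: 'X_q.

Definition kext (i : nat) (v : {ffun kgen i -> S}) C : S :=
  if insub C is Some c then v c else 0.

Definition kd G C : S :=
  \sum_(q | q \notin C) (-1) ^+ kpos q C *: ('X_q * G (q |: C)).

Definition ksub i C (h : #|C| == i) : kgen i := exist _ C h.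

Lemma val_ksub i C (h : #|C| == i) : val (ksub h) = C.
Proof. by []. Qed.

Lemma kext_val i (v : {ffun kgen i -> S}) (c : kgen i) : kext v (val c) = v c.
Proof. by rewrite /kext valK. Qed.

Lemma kext_card i (v : {ffun kgen i -> S}) C : #|C| != i -> kext v C = 0.
Proof. by move=> h; rewrite /kext insubN. Qed.

Lemma kposU p q C : (p <= q)%N = false ->
  kpos p (q |: C) = (kpos p C + (q \notin C))%N.
Proof.
move/negbT; rewrite -ltnNge => ltqp; rewrite /kpos.
have [qC|qC] := boolP (q \in C).
  rewrite addn0; apply: eq_card => r; rewrite !inE; case: eqP => // ->.
  by rewrite qC.
rewrite addn1 (cardD1 q) !inE eqxx ltqp /= add1n; congr _.+1.
apply: eq_card => r; rewrite !inE; case: eqP => // ->.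
by rewrite (negPf qC).
Qed.

Lemma kposU_le p q C : (p <= q)%N -> kpos p (q |: C) = kpos p C.
Proof.
move=> lepq; apply: eq_card => r; rewrite !inE.
by case: eqP => // ->; rewrite ltnNge lepq !andbF.
Qed.

Lemma free_mapE i (w : {ffun kgen i.+1 -> S}) (c : kgen i) :
  free_map (@kdiff i) w c = kd (kext w) (val c).
Proof.
rewrite ffunE /kdiff.
under eq_bigr do rewrite mulr_sumr.
rewrite (exchange_big_dep xpredT) /=; last by [].
rewrite (bigID (fun q => q \in val c)) /= big1 ?add0r => [|q qc].
  apply: eq_bigr => q qc.
  have ha : #|q |: val c| == i.+1 by rewrite cardsU1 qc (eqP (valP c)) add1n.
  rewrite (big_pred1 (ksub ha)) => [|a].
    have -> : kext w (q |: val c) = w (ksub ha).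
      by rewrite -(kext_val w).
    by rewrite val_ksub kposU_le // -scalerAr mulrC.
  apply/andP/eqP => [[qa /eqP e]|->].
    by apply: val_inj; rewrite /= -e finset.setD1K.
  by rewrite val_ksub setU11 finset.setU1K.
by rewrite big1 // => a /andP[qa /eqP e]; rewrite -e !inE eqxx in qc.
Qed.

Lemma kext_free_map i (w : {ffun kgen i.+1 -> S}) C :
  kext (free_map (@kdiff i) w) C = kd (kext w) C.
Proof.
have [h|h] := boolP (#|C| == i).
  by rewrite -(val_ksub h) kext_val free_mapE.
rewrite kext_card // /kd big1 // => q qC.
by rewrite kext_card ?mulr0 ?scaler0 // cardsU1 qC.
Qed.

Lemma kdd G C : kd (kd G) C = 0.
Proof.
pose T q r : S :=
  (-1) ^+ (kpos q C + kpos r C) *: ('X_q * 'X_r * G (r |: (q |: C))).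
have -> : kd (kd G) C =
    \sum_(q | q \notin C) \sum_(r | (r \notin C) && (r != q))
       (if (q < r)%N then - T q r else T q r).
  apply: eq_bigr => q qC; rewrite /kd mulr_sumr scaler_sumr.
  apply: eq_big => [r|r]; first by rewrite !inE negb_or andbC.
  rewrite !inE negb_or => /andP[rq rC].
  rewrite -scalerAr scalerA -exprD mulrA /T.
  case: ltnP => [lt|le]; last by rewrite kposU_le.
  by rewrite kposU ?qC ?addn1 ?addnS ?exprS ?mulN1r ?scaleNr // leqNgt lt.
have sym q r : T q r = T r q.
  by rewrite /T addnC (mulrC 'X_q) finset.setUCA.
have -> : \sum_(q | q \notin C) \sum_(r | (r \notin C) && (r != q))
       (if (q < r)%N then - T q r else T q r)
  = \sum_(q | q \notin C) \sum_(r | (r \notin C) && (q < r)%N) (- T q r)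
  + \sum_(q | q \notin C) \sum_(r | (r \notin C) && (r < q)%N) T q r.
  rewrite -big_split; apply: eq_bigr => q qC /=.
  rewrite (bigID (fun r : 'I_n => (q < r)%N)) /=; congr (_ + _).
    apply: eq_big => [r|r /andP[_ ->] //].
    by rewrite -andbA -(inj_eq val_inj) /=; case: ltngtP => //; rewrite !andbF.
  apply: eq_big => [r|r /andP[_ /negPf ->] //].
  by rewrite -andbA -(inj_eq val_inj) /=; case: ltngtP => //; rewrite !andbF.
rewrite (exchange_big_dep (fun r => r \notin C)) /=; last by move=> ? ? _ /andP[].
rewrite -big_split big1 // => q qC /=.
rewrite [X in X + _](eq_bigl (fun r => (r \notin C) && (r < q)%N)); last first.
  by move=> r; rewrite /= qC.
by rewrite -big_split big1 //= => r _; rewrite sym addNr.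
Qed.

(* A contracting homotopy in positive multidegrees, on the basis x^m e_C: if p
   is the least element of supp(m) \cup C, then x^m e_C maps to
   x^(m - p) e_(C \cup p) when p is not in C, and to 0 otherwise. *)
Definition kmin p C m :=
  [forall r : 'I_n, (r < p)%N ==> (r \notin C) && (m r == 0%N)].

Definition kh G C : S :=
  \sum_(p in C) \sum_(m <- msupp (G (C :\ p)) | (0 < m p)%N && kmin p C m)
     (G (C :\ p))@_m *: 'X_[m - U_(p)].

Lemma kminU p C m : kmin p C (m + U_(p)) = kmin p C m.
Proof.
apply: eq_forallb => r; case: ltnP => //= lt.
by rewrite mnmDE mnm1E -[p == r](inj_eq val_inj) /= (gtn_eqF lt) addn0.
Qed.

Lemma khE G C m :
  (kh G C)@_m = \sum_(p in C | kmin p C m) (G (C :\ p))@_(m + U_(p)).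
Proof.
rewrite /kh raddf_sum [RHS]big_mkcondr; apply: eq_bigr => p pC /=.
rewrite raddf_sum /=.
have E m' : (0 < m' p)%N -> ((m' - U_(p))%MM == m) = (m' == (m + U_(p))%MM).
  move=> h; have U : (U_(p) <= m')%MM.
    by apply/mnm_lepP => r; rewrite mnm1E; case: eqP => [<-|].
  by rewrite -[X in _ = (X == _)](submK U) eqm_add2r.
rewrite (bigID (fun m' => m' == (m + U_(p))%MM)) /= [X in _ + X]big1 ?addr0.
  rewrite big_mkcond /=.
  have [ms|ms] := boolP ((m + U_(p))%MM \in msupp (G (C :\ p))).
    rewrite (bigD1_seq _ ms (msupp_uniq _)) /= big1 => [|m' /negPf ->].
      rewrite eqxx andbT addr0 mnmDE mnm1E eqxx addn1 /= kminU.
      by case: ifP => // _; rewrite mcoeffZ mcoeffX addmK eqxx mulr1.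
    by rewrite andbF.
  rewrite (memN_msupp_eq0 ms) if_same big_seq big1 // => m' m's.
  case: ifP => // /andP[_ /eqP e]; by rewrite e (negPf ms) in m's.
move=> m' /andP[/andP[h _] ne].
by rewrite mcoeffZ mcoeffX E // (negPf ne) mulr0.
Qed.

Lemma kdE G C m :
  (kd G C)@_m = \sum_(q | (q \notin C) && (0 < m q)%N)
     (-1) ^+ kpos q C * (G (q |: C))@_(m - U_(q)).
Proof.
rewrite /kd raddf_sum [RHS]big_mkcondr; apply: eq_bigr => q qC /=.
rewrite mcoeffZ ['X_q * _]mulrC; case: ltnP => h.
  have U : (U_(q) <= m)%MM.
    by apply/mnm_lepP => r; rewrite mnm1E; case: eqP => [<-|].
  by rewrite -{1}(submK U) addmC mcoeffMX.
rewrite mcoeffM big1 ?mulr0 // => -[m1 m2] /= /eqP e.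
rewrite mcoeffX; case: eqP => [e'|]; last by rewrite mulr0.
have := congr1 (fun m' : 'X_{1..n} => m' q) e.
by rewrite -e' mnmDE mnm1E eqxx addn1 => E; rewrite E in h.
Qed.

Lemma kminP p C m :
  reflect (forall r, (r < p)%N -> r \notin C /\ m r = 0%N) (kmin p C m).
Proof.
apply: (iffP forallP) => h r.
  by move=> lt; move: (h r); rewrite lt => /andP[? /eqP].
by apply/implyP => /h[-> ->].
Qed.

Lemma kh_homotopy G : (G finset.set0)@_0%MM = 0 -> (forall C, kd G C = 0) ->
  forall C, kd (kh G) C = G C.
Proof.
move=> G0 dG C; apply/mpolyP => m; rewrite kdE.
have [/existsP[p0 hp0]|] :=
  boolP [exists p, (p \in C) || (0 < m p)%N]; last first.
  rewrite negb_exists => /forallP h.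
  have -> : C = finset.set0.
    apply/setP => r; rewrite inE.
    by move: (h r); rewrite negb_or => /andP[/negPf].
  have -> : m = 0%MM.
    apply/mnmP => r; rewrite mnm0E; move: (h r).
    by rewrite negb_or -leqNgt leqn0 => /andP[_ /eqP].
  by rewrite G0 big1 // => q; rewrite mnm0E andbF.
have [p hp pmin] : exists2 p, (p \in C) || (0 < m p)%N &
    forall r, (r < p)%N -> r \notin C /\ m r = 0%N.
  pose Q r := (r \in C) || (0 < m r)%N.
  case: (@arg_minnP _ p0 Q (fun r : 'I_n => nat_of_ord r) hp0) => p hp pm.
  exists p => // r lt; have : ~~ ((r \in C) || (0 < m r)%N).
    by apply: contraL lt => /pm; rewrite -leqNgt.
  by rewrite negb_or -leqNgt leqn0 => /andP[? /eqP].
have khq q : q \notin C -> (0 < m q)%N ->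
    (kh G (q |: C))@_(m - U_(q)) =
    if p \in q |: C then (G ((q |: C) :\ p))@_(m - U_(q) + U_(p)) else 0.
  move=> qC mq; rewrite khE.
  have kp : kmin p (q |: C) (m - U_(q)).
    apply/kminP => r lt; have [rC mr] := pmin r lt.
    rewrite !inE negb_or rC mnmBE mr sub0n; split=> //; rewrite andbT.
    by apply: contraTneq mq => <-; rewrite mr.
  have uniq p' : p' \in q |: C -> kmin p' (q |: C) (m - U_(q)) -> p' = p.
    move=> p'C kp'; case: (ltngtP p' p) => [lt|lt|/val_inj] //.
      by have [] := kminP _ _ _ kp p' lt; rewrite p'C.
    have [] := kminP _ _ _ kp' p lt; rewrite !inE negb_or => /andP[pq pC].
    move: hp; rewrite (negPf pC) /= mnmBE mnm1E eq_sym (negPf pq) subn0.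
    by move=> + e; rewrite e.
  case: ifP => pC.
    rewrite (big_pred1 p) // => p'; rewrite /=.
    apply/andP/eqP => [[]|->]; [exact: uniq | by []].
  rewrite big1 // => p' /andP[h1 h2]; by move: (h1); rewrite (uniq _ h1 h2) pC.
have [pC|pC] := boolP (p \in C); last first.
  rewrite (negPf pC) /= in hp.
  rewrite (bigD1 p) ?pC ?hp //= big1 => [|q /andP[/andP[qC mq] qp]].
    rewrite addr0 khq // setU11 finset.setU1K // submK; last first.
      by apply/mnm_lepP => r; rewrite mnm1E; case: eqP => [<-|].
    have -> : kpos p C = 0%N.
      apply: eq_card0 => r; rewrite !inE; apply/negP => /andP[rC lt].
      by have [] := pmin r lt; rewrite rC.
    by rewrite expr0 mul1r.
  by rewrite khq // !inE (negPf pC) eq_sym (negPf qp) mulr0.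
have := congr1 (mcoeff (m + U_(p))) (dG (C :\ p)).
rewrite mcoeff0 kdE.
have mp : (0 < (m + U_(p))%MM p)%N by rewrite mnmDE mnm1E eqxx addn1.
rewrite (bigD1 p) /=; last by rewrite !inE eqxx mp.
have -> : kpos p (C :\ p) = 0%N.
  apply: eq_card0 => r; rewrite !inE; apply/negP => /andP[/andP[_ rC] lt].
  by have [] := pmin r lt; rewrite rC.
rewrite expr0 mul1r finset.setD1K // addmK => /eqP.
rewrite addr_eq0 => /eqP ->; rewrite -sumrN; apply: eq_big => [q|q].
  rewrite !inE negb_and negbK mnmDE mnm1E.
  case: (eqVneq q p) => [->|qp] /=; first by rewrite pC andbF.
  by rewrite addn0 andbT.
move=> /andP[qC mq]; have qp : q != p by apply: contraNneq qC => ->.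
have ltpq : (p < q)%N.
  rewrite ltnNge leq_eqVlt negb_or (inj_eq val_inj) qp /=.
  by apply: contraL mq => /pmin[_ ->].
rewrite khq // !inE pC orbT -mulNr.
have -> : kpos q C = (kpos q (C :\ p)).+1.
  rewrite -{1}(finset.setD1K pC) kposU; last by rewrite leqNgt ltpq.
  by rewrite !inE eqxx addn1.
rewrite exprS mulN1r; congr (_ * _).
have -> : (q |: C) :\ p = q |: C :\ p.
  apply/setP => r; rewrite !inE.
  by case: (eqVneq r q) => [->|_] //=; rewrite qp.
congr (mcoeff _ _); apply/mnmP => r; rewrite !mnmE.
case: (eqVneq q r) => [<-|_]; last by rewrite !subn0.
by rewrite eq_sym (negPf qp) !addn0.
Qed.

Lemma kexact i (v : {ffun kgen i -> S}) : (kext v finset.set0)@_0%MM = 0 ->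
  (forall C, kd (kext v) C = 0) -> exists w, v = free_map (@kdiff i) w.
Proof.
move=> v0 dv; exists [ffun a : kgen i.+1 => kh (kext v) (val a)].
apply/ffunP => c; rewrite free_mapE -kext_val -(kh_homotopy v0 dv).
apply: eq_bigr => q qc; congr (_ *: (_ * _)).
have h : #|q |: val c| == i.+1 by rewrite cardsU1 qc (eqP (valP c)) add1n.
by rewrite -(val_ksub h) kext_val ffunE.
Qed.

Lemma kdiff_homog i (a : kgen i.+1) (c : kgen i) :
  shift_homog i i.+1 (kdiff a c).
Proof.
rewrite /shift_homog leqnSn subSnn; apply: rpred_sum => q _.
by apply: rpredZ; rewrite dhomogX; apply/eqP/mdeg1.
Qed.

Definition kset0 : kgen 0 := ksub (introT eqP (cards0 'I_n)).

Lemma kaugE (v : {ffun kgen 0 -> S}) :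
  augmentation (fun=> 1) v = (v kset0)@_0%MM.
Proof.
rewrite /augmentation (big_pred1 kset0) => [|a]; first by rewrite mulr1.
symmetry; apply/eqP/val_inj => /=; apply/eqP.
by rewrite -cards_eq0 (valP a).
Qed.

Lemma kaug_surj :
  exists v : {ffun kgen 0 -> S}, augmentation (fun=> 1) v = 1.
Proof. by exists [ffun=> 1]; rewrite kaugE ffunE mcoeff1 eqxx. Qed.

Lemma kexact_aug (v : {ffun kgen 0 -> S}) :
  augmentation (fun=> 1) v = 0 <-> exists w, v = free_map (@kdiff 0) w.
Proof.
rewrite kaugE; split=> [v0|[w ->]]; last first.
  by rewrite free_mapE kdE big1 // => q; rewrite mnm0E andbF.
apply: kexact => [|C]; first by rewrite -[finset.set0]/(val kset0) kext_val.
by rewrite /kd big1 // => q qC; rewrite kext_card ?mulr0 ?scaler0 // cardsU1 qC.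
Qed.

Lemma kexact_diff i (v : {ffun kgen i.+1 -> S}) :
  free_map (@kdiff i) v = 0 <-> exists w, v = free_map (@kdiff i.+1) w.
Proof.
split=> [dv|[w ->]].
  apply: kexact => [|C]; first by rewrite kext_card ?mcoeff0 // cards0.
  rewrite -kext_free_map dv /kext; case: insub => // c; by rewrite ffunE.
apply/ffunP => c; rewrite free_mapE [RHS]ffunE -[RHS](kdd (kext w) (val c)).
by apply: eq_bigr => q _; rewrite kext_free_map.
Qed.

Definition koszul : resolution k n :=
  @Resolution k n kgen (fun i _ => i) kdiff (fun=> 1) kdiff_homog
    (fun _ _ => erefl) kaug_surj kexact_aug kexact_diff.

End Koszul.

(* b_{i,j}(J) = dim_k Tor_i^S(k, J)_j, for the ideal J as a graded S-module *)
Definition betti (k : fieldType) (n : nat) (J : set {mpoly k[n]}) (i j : nat) :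
    nat :=
  tor_dim (koszul k n) J i j.

(* Main.v *)
Require Import Defs.
From HB Require Import structures.
From mathcomp Require Import all_boot all_order all_algebra zify ring.
From mathcomp Require Import mpoly.
From mathcomp Require boolp.

Set Implicit Arguments.
Unset Strict Implicit.
Unset Printing Implicit Defensive.

Import GRing.Theory.

(** Fix variables x_a, x_b with a < b. Compression replaces, among the monomials
    with prescribed exponents outside {a, b} and prescribed degree, those of
    x_b-exponent less than e_b by the same number of monomials with the smallest
    x_b-exponents. The result is again an ideal containing P (this uses
    e_a <= e_b), with the same Hilbert function. Iterating over all pairs, each
    degree becomes stationary, and the limit is Borel-plus-P.

    The point is that compression does not decrease Betti numbers. Up to terms
    depending on the Hilbert function only, these are dimensions of spaces of
    Koszul cycles, one for each multidegree. In the multidegrees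
    g x_a^(N - t) x_b^t, t = 0, ..., N, the sum of these dimensions is at most a
    sum of numbers kappa(X, Y) = dim {z supported on Y | dz supported on X}, where
    d is the Koszul differential in the variables other than x_a, x_b; there is
    equality after compression. As kappa is supermodular, sorting the supports
    does not decrease this sum; and as dd = 0, neither does moving faces from a
    set U of allowed boundaries into the support R of another term:
    kappa(X, R) + kappa(U, Z) <= kappa(X, R \cup U) + kappa(R \cap U, Z).
    Sorting and moving lead to the supports of the compressed ideal. *)

(** * Coordinate subspaces and relative cycles *)

(** The obstacle is that the sets [X1] of (a, b)-degree N - 1 enter twice: intersections of
    neighbouring positions are supports of cycles, unions of neighbouring positions are supports of
    boundaries. A face present at c scattered positions lies in p intersections and q unions, where
    only p + q = 2c is known; an initial segment of c positions, not the whole cycle, gives c - 1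
    and c + 1. Sorting the two families separately leaves p and q as they are, so a surplus of
    unions has to be turned into intersections, and this is what the transfer inequality achieves.
    Positions form a cycle because monomials of x_b-exponent e_b and monomials of x_a-exponent at
    least e_b both lie in P, so the two ends of the range look alike. Equality holds after
    compression because neighbouring [X1] are then nested: a boundary supported on their union is
    supported on one of them and can be cancelled using a single variable. Betti numbers reduce to
    cycles by rank and nullity: b_i is the dimension of i-cycles plus that of (i+1)-cycles minus the
    number of faces of size i + 1, and compression preserves face counts. *)

Section CoordinateSubspaces.
Local Open Scope ring_scope.
Variables (k : fieldType) (T : finType).
Local Notation V := {ffun T -> k^o}.
Implicit Types (X Y Z U R : {set T}) (v : V).

Definition off X v : V := [ffun t => if t \in X then 0 else v t].

Fact off_is_linear X : linear (off X).
Proof.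
move=> a u v; apply/ffunP => t; rewrite !ffunE.
by case: ifP => // _; rewrite scaler0 addr0.
Qed.
HB.instance Definition _ X :=
  GRing.isLinear.Build k V V _ (off X) (off_is_linear X).

Definition coords X : {vspace V} := lker (linfun (off X)).

Lemma coordsP X v :
  reflect (forall t, t \notin X -> v t = 0) (v \in coords X).
Proof.
rewrite memv_ker lfunE /=; apply: (iffP eqP) => [h t tX|h].
  by move/ffunP/(_ t): h; rewrite !ffunE (negPf tX).
by apply/ffunP => t; rewrite !ffunE; case: ifPn => // /h.
Qed.

Lemma coordsS X Y : X \subset Y -> (coords X <= coords Y)%VS.
Proof.
move=> /subsetP XY; apply/subvP => v /coordsP h; apply/coordsP => t tY.
by apply: h; apply: contraNN tY => /XY.
Qed.

Lemma coordsI X Y : coords (X :&: Y) = (coords X :&: coords Y)%VS.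
Proof.
apply/vspaceP => v; rewrite memv_cap;
  apply/coordsP/andP => [h|[/coordsP h /coordsP h'] t].
  by split; apply/coordsP => t tX; apply: h; rewrite inE (negPf tX) ?andbF.
by rewrite inE negb_and => /orP[/h|/h'].
Qed.

Lemma coordsU X Y : coords (X :|: Y) = (coords X + coords Y)%VS.
Proof.
apply/eqP; rewrite eqEsubv; apply/andP; split; last first.
  by rewrite subv_add !coordsS ?subsetUl ?subsetUr.
apply/subvP => v /coordsP h.
have -> : v = off X v + (v - off X v) by rewrite addrC subrK.
rewrite addrC; apply: memv_add; apply/coordsP => t tX; rewrite !ffunE.
  by rewrite (negPf tX) subrr.
by case: ifPn => // tX'; apply: h; rewrite inE negb_or tX tX'.
Qed.

(** Unit vectors give the upper bound. The lower bound follows from the upper bound for the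
    complement, as the two coordinate subspaces span everything. *)
Lemma dim_coords X : \dim (coords X) = #|X|.
Proof.
have le Y : (\dim (coords Y) <= #|Y|)%N.
  pose e t : V := [ffun u => (u == t)%:R].
  rewrite cardE -(size_map e); apply: leq_trans (dim_span _); apply: dimvS.
  apply/subvP => v /coordsP h.
  have -> : v = \sum_(t in Y) (v t : k) *: e t.
    apply/ffunP => u; rewrite sum_ffunE.
    have [uY|uY] := boolP (u \in Y).
      rewrite (bigD1 u) //= big1 => [|t /andP[_ tu]]; rewrite !ffunE ?eqxx ?addr0.
        by rewrite [_ *: _]mulr1.
      by rewrite eq_sym (negPf tu) scaler0.
    rewrite h // big1 // => t tY; rewrite !ffunE; case: eqP => [E|_].
      by rewrite E tY in uY.
    by rewrite scaler0.
  by apply: memv_suml => t tY; apply/memvZ/memv_span/map_f; rewrite mem_enum.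
apply/eqP; rewrite eqn_leq le /= -(leq_add2r (\dim (coords (~: X)))).
rewrite -dimv_sum_cap -coordsU -coordsI setUCr setICr.
have -> : coords setT = fullv.
  by apply/vspaceP => v; rewrite memvf; apply/coordsP => t; rewrite inE.
rewrite dimvf (_ : dim V = #|T| * 1)%N // muln1.
by rewrite -(cardsC X); apply: leq_trans (leq_addr _ _); rewrite leq_add2l.
Qed.
End CoordinateSubspaces.

Section RelativeCycles.
Local Open Scope ring_scope.
Variables (k : fieldType) (T : finType).
Local Notation V := {ffun T -> k^o}.
Variable d : 'End(V).
Hypothesis dd : forall v, d (d v) = 0.
Implicit Types (X Y Z U R : {set T}) (v : V).

Definition relcycles X Y : {vspace V} := (coords k Y :&: d @^-1: coords k X)%VS.

Definition rank_relcycles X Y := \dim (relcycles X Y).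

Lemma relcyclesP X Y v :
  reflect (v \in coords k Y /\ d v \in coords k X) (v \in relcycles X Y).
Proof. by rewrite memv_cap memv_preim; apply: andP. Qed.

Lemma relcyclesS X Y X' Y' : X \subset X' -> Y \subset Y' ->
  (relcycles X Y <= relcycles X' Y')%VS.
Proof.
move=> XX YY; apply/subvP => v /relcyclesP[vY dX]; apply/relcyclesP.
by split; [apply: subvP vY | apply: subvP dX]; apply: coordsS.
Qed.

(** Intersecting supports intersects the spaces exactly, whereas the sum of two spaces only lands in
    the space of the unions; the dimension formula for a sum and an intersection does the rest. *)
Lemma rank_relcycles_supermodular X Y X' Y' :
  (rank_relcycles X Y + rank_relcycles X' Y' <=
   rank_relcycles (X :|: X') (Y :|: Y') +
   rank_relcycles (X :&: X') (Y :&: Y'))%N.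
Proof.
rewrite -dimv_sum_cap leq_add // dimvS //.
  by rewrite subv_add !relcyclesS ?subsetUl ?subsetUr.
apply/subvP => v; rewrite memv_cap => /andP[/relcyclesP[h1 h2] /relcyclesP[h3 h4]].
by apply/relcyclesP; rewrite !coordsI !memv_cap h1 h2 h3 h4.
Qed.

(* The boundaries of Z lying in U are cycles, hence lie in [relcycles X U];
   those lying in R are already counted by [relcycles (R :&: U) Z]. *)
Lemma rank_relcycles_transfer X R U Z :
  (rank_relcycles X R + rank_relcycles U Z <=
   rank_relcycles X (R :|: U) + rank_relcycles (R :&: U) Z)%N.
Proof.
rewrite /rank_relcycles -[\dim (relcycles U Z)](limg_ker_dim d).
rewrite -[\dim (relcycles (R :&: U) Z)](limg_ker_dim d).
have -> : (relcycles U Z :&: lker d)%VS = (relcycles (R :&: U) Z :&: lker d)%VS.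
  apply/vspaceP => v; rewrite /relcycles !memv_cap -!memv_preim (memv_ker d).
  by case: eqP => [->|]; rewrite ?andbF // !mem0v.
rewrite addnCA [X in (_ <= X)%N]addnCA leq_add2l -dimv_sum_cap leq_add ?dimvS //.
  rewrite subv_add relcyclesS ?subsetUl //=.
  apply/subvP => _ /memv_imgP[v /relcyclesP[_ dU] ->]; apply/relcyclesP.
  by rewrite dd mem0v; split=> //; apply: subvP dU; apply: coordsS (subsetUr _ _).
apply/subvP => w; rewrite memv_cap => /andP[/relcyclesP[wR _]].
move=> /memv_imgP[v /relcyclesP[vZ dU] E]; rewrite {}E in wR *.
by apply: memv_img; apply/relcyclesP; rewrite coordsI memv_cap wR dU.
Qed.

End RelativeCycles.

(** * Sorting families of sets *)

Lemma sum_bool_leq m (u : 'I_m -> bool) : \sum_(t < m) u t <= m.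
Proof.
rewrite -[leqRHS]muln1 -[X in X * 1]card_ord -sum_nat_const.
by apply: leq_sum => t _; apply: leq_b1.
Qed.

Section Levels.
Variable T : finType.
Implicit Types (c p q : T -> nat) (x : nat -> {set T}).

(** When c counts the occurrences of each element in a family of sets, the levels are the sorted
    family: same multiplicities, but a decreasing chain. *)
Definition level c l := [set e | l < c e].

Definition count_in m x e := \sum_(t < m) (e \in x t).

Lemma count_in_le m x e : count_in m x e <= m.
Proof. exact: sum_bool_leq. Qed.

(** X is passed through the levels: each level absorbs the elements it lacks and hands on the
    intersection. So e is absorbed at level c e, the first that does not contain it, and what is
    left at the end lies in all m levels. *)
Lemma insert_level (F : nat -> {set T} -> nat) (G : {set T} -> nat) c X m :
  (forall t X Y, t < m -> F t X + G Y <= F t (X :|: Y) + G (X :&: Y)) ->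
  \sum_(t < m) F t (level c t) + G X <=
  \sum_(t < m) F t (level (fun e => c e + (e \in X)) t)
    + G [set e in X | m <= c e].
Proof.
elim: m => [|m IH] H.
  rewrite !big_ord0 leq_eqVlt; apply/orP; left; apply/eqP; congr (_ + G _).
  by apply/setP => e; rewrite !inE andbT.
rewrite !big_ord_recr /= addnAC.
apply: (@leq_trans (\sum_(t < m) F t (level (fun e => c e + (e \in X)) t)
    + G [set e in X | m <= c e] + F m (level c m))).
  by rewrite leq_add2r; apply: IH => t Y Z tm; apply: H; apply: ltnW.
rewrite -!addnA leq_add2l addnC; apply: leq_trans (H _ _ _ (leqnn _)) _.
apply: eq_leq; congr (F _ _ + G _);
  apply/setP => e; rewrite !inE; case: (e \in X) => /=; lia.
Qed.

(** This is insertion sort: [insert_level] inserts the last set into the sorted earlier ones. *)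
Lemma sort_levels (F : nat -> {set T} -> nat) x m :
  (forall s t X Y, s < t < m -> F s X + F t Y <= F s (X :|: Y) + F t (X :&: Y)) ->
  \sum_(t < m) F t (x t) <= \sum_(t < m) F t (level (count_in m x) t).
Proof.
elim: m => [|m IH] H; first by rewrite !big_ord0.
rewrite !big_ord_recr /=.
apply: (@leq_trans (\sum_(t < m) F t (level (count_in m x) t) + F m (x m))).
  rewrite leq_add2r; apply: IH => s t X Y /andP[st tm]; apply: H.
  by rewrite st ltnW.
have Hm t X Y : t < m -> F t X + F m Y <= F t (X :|: Y) + F m (X :&: Y).
  by move=> tm; apply: H; rewrite tm leqnn.
apply: leq_trans (insert_level _ _ Hm) _.
have E e : count_in m.+1 x e = count_in m x e + (e \in x m).
  by rewrite /count_in big_ord_recr.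
apply: eq_leq; congr (_ + F _ _).
  by apply: eq_bigr => t _; congr (F _ _); apply/setP => e; rewrite !inE E.
apply/setP => e; rewrite !inE E; have := count_in_le m x e.
by case: (e \in x m) => /=; lia.
Qed.

(* Swap fr at i = p e and fu at j = q e - 1 for an element e with q e - p e
   maximal: by maximality this moves exactly the elements with the same p and q
   as e, each from level j of q to level i of p. *)
Lemma transfer_levels h (fr fu : nat -> {set T} -> nat) p q p' q' :
  (forall i j R U, fr i R + fu j U <= fr i (R :|: U) + fu j (R :&: U)) ->
  (forall e, [/\ q e <= h, q' e <= q e, p e + q e = p' e + q' e,
     q' e <= p' e + 2 & q' e < q e -> q' e = p' e + 2]) ->
  \sum_(i < h) fr i (level p i) + \sum_(j < h) fu j (level q j) <=
  \sum_(i < h) fr i (level p' i) + \sum_(j < h) fu j (level q' j).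
Proof.
move=> H; move: {2}(\sum_e (q e - q' e)) (leqnn (\sum_e (q e - q' e))) => s.
elim: s p q => [|s IH] p q les hyp.
  have Eq e : q e = q' e.
    have [_ h1 _ _ _] := hyp e; apply/eqP; rewrite eqn_leq h1 andbT -subn_eq0.
    by move: les; rewrite leqn0 sum_nat_eq0 => /forallP /(_ e).
  have Ep e : p e = p' e by have [_ _ + _ _] := hyp e; rewrite Eq => /addIn.
  apply: eq_leq; congr (_ + _); apply: eq_bigr => t _.
    by congr (fr t _); apply/setP => e; rewrite !inE Ep.
  by congr (fu t _); apply/setP => e; rewrite !inE Eq.
have [/forallP Eq|] := boolP [forall e, q e <= q' e].
  apply: IH => //; rewrite big1 // => e _; apply/eqP; rewrite subn_eq0; exact: Eq.
rewrite negb_forall => /existsP[e1]; rewrite -ltnNge => lt1.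
case: (@arg_maxnP _ e1 xpredT (fun e => q e - p e)) => // e0 _ max0.
(* Since p + q is fixed and a surplus element has target q' - p' = 2, a surplus of s makes q - p
   equal to 2 + 2s. All elements moved together with e0 share this difference, so each of them has a
   surplus too. *)
have q0 : 4 <= q e0 - p e0.
  by apply: leq_trans (max0 e1 isT); have [] := hyp e1; lia.
pose b e := (p e <= p e0) && ((q e0).-1 < q e).
have bP e : b e -> p e = p e0 /\ q e = q e0.
  by move=> /andP[]; move: (max0 e isT) => /=; have [] := hyp e; lia.
pose p1 e := p e + b e; pose q1 e := q e - b e.
apply: (@leq_trans (\sum_(i < h) fr i (level p1 i) +
  \sum_(j < h) fu j (level q1 j))); last first.
  apply: IH => [|e]; last first.
    have [h1 h2 h3 h4 h5] := hyp e; rewrite /p1 /q1.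
    case be: (b e) => /=; last by rewrite addn0 subn0.
    have [ep eq] := bP e be; split; lia.
  rewrite -ltnS; apply: leq_trans les.
  rewrite (bigD1 e0) //= [in X in _ < X](bigD1 e0) //= -addSn; apply: leq_add.
    rewrite /q1 /b leqnn /= prednK ?leqnn //; last by lia.
    by have [] := hyp e0; lia.
  by apply: leq_sum => e _; rewrite /q1; lia.
have qh : q e0 <= h by have [] := hyp e0.
have ih : p e0 < h by lia.
have jh : (q e0).-1 < h by lia.
have split1 (i : 'I_h) (F : 'I_h -> nat) :
  \sum_j F j = F i + \sum_(j | j != i) F j by rewrite (bigD1 i).
rewrite !(split1 (Ordinal ih) (fun i => fr i _)) /=.
rewrite !(split1 (Ordinal jh) (fun j => fu j _)) /=.
rewrite addnACA [leqRHS]addnACA; apply: leq_add.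
  apply: leq_trans (H _ _ _ _) _.
  apply: eq_leq; congr (fr _ _ + fu _ _);
    apply/setP => e; rewrite !inE /p1 /q1; case be: (b e) => /=.
  - by have [] := bP e be; lia.
  - by move: be; rewrite /b; lia.
  - by have [] := bP e be; lia.
  - by move: be; rewrite /b; lia.
apply: leq_add; apply: leq_sum => t /eqP nt; apply: eq_leq.
  congr (fr t _); apply/setP => e; rewrite !inE /p1; case be: (b e);
    rewrite ?addn0 //; have [ep eq] := bP e be.
  have : nat_of_ord t <> p e0 by move=> E; apply: nt; apply: val_inj.
  by rewrite ep; lia.
congr (fu t _); apply/setP => e; rewrite !inE /q1; case be: (b e);
  rewrite ?subn0 //; have [ep eq] := bP e be.
have : nat_of_ord t <> (q e0).-1 by move=> E; apply: nt; apply: val_inj.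
by rewrite eq; lia.
Qed.

End Levels.

(** Here p and q are the sizes of the intersection and the union of u with its rotation by one step
    on a cycle of m + 1 points, so p + q = 2c. If q = c, then u is stable under rotation, hence
    empty or everything. *)
Lemma cyclic_counts (m : nat) (u : nat -> bool) :
  let c := \sum_(t < m.+1) u t in
  let p := \sum_(t < m) (u t && u t.+1) + (u 0 && u m) in
  let q := (u 0 || u m) + \sum_(t < m) (u t.+1 || u t) in
  p + q = c + c /\ (c < q \/ c = 0 /\ q = 0 \/ c = m.+1 /\ q = m.+1).
Proof.
move=> c p q.
have cl : c = u 0 + \sum_(t < m) u t.+1 by rewrite /c big_ord_recl.
have cr : c = \sum_(t < m) u t + u m by rewrite /c big_ord_recr.
have S : \sum_(t < m) (u t && u t.+1) + \sum_(t < m) (u t.+1 || u t) =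
         \sum_(t < m) u t.+1 + \sum_(t < m) u t.
  by rewrite -!big_split; apply: eq_bigr => t _; case: (u t); case: (u t.+1).
have E : p + q = c + c.
  rewrite {1}cl cr /p /q.
  by move: S; case: (u 0); case: (u m) => /=; lia.
split=> //.
have S' : \sum_(t < m) (u t.+1 || u t) =
    \sum_(t < m) u t.+1 + \sum_(t < m) (u t && ~~ u t.+1).
  by rewrite -big_split; apply: eq_bigr => t _; case: (u t); case: (u t.+1).
have [ltcq|leqc] := ltnP c q; first by left.
right.
have d0 : \sum_(t < m) (u t && ~~ u t.+1) = 0.
  by move: leqc; rewrite cl /q S'; case: (u 0); case: (u m) => /=; lia.
have um0 : u m -> u 0.
  by move: leqc; rewrite cl /q S'; case: (u 0); case: (u m) => //=; lia.
have up t : t < m -> u t -> u t.+1.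
  move=> tm; move: d0 => /eqP; rewrite sum_nat_eq0 => /forallP /(_ (Ordinal tm)).
  by case: (u t); case: (u t.+1).
have upm t s : t + s <= m -> u t -> u (t + s).
  elim: s => [|s IH]; rewrite ?addn0 // addnS => h ut.
  by apply: up => //; apply: IH ut; apply: ltnW.
have [u0|nu0] := boolP (u 0).
  have all t : t <= m -> u t by move=> tm; exact: (upm 0 t tm u0).
  right; rewrite /c /q u0 (eq_bigr (fun=> 1)) => [|t _]; last first.
    by rewrite all // -ltnS.
  rewrite sum1_card card_ord (eq_bigr (fun=> 1)) => [|t _]; last first.
    by rewrite all // ltnW.
  by rewrite sum1_card card_ord.
have none t : t <= m -> ~~ u t.
  move=> tm; apply: contra nu0 => ut; apply: um0.
  by rewrite -(subnKC tm); apply: upm; rewrite ?subnKC.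
left; rewrite /c /q (negPf nu0) (negPf (none m (leqnn m))).
split; rewrite big1 // => t _; first by rewrite (negPf (none t _)) // -ltnS.
by rewrite (negPf (none t.+1 _)) ?(negPf (none t _)) // ltnW.
Qed.

(** * Compression of cyclic families *)

Section CyclicCompression.
Variables (k : fieldType) (T : finType).
Local Notation V := {ffun T -> k^o}.
Variable d : 'End(V).
Hypothesis dd : forall v, d (d v) = 0%R.
Implicit Types X Y Z : nat -> {set T}.

Local Notation kappa := (rank_relcycles d).

(** Coding two supports as one subset of a disjoint union makes [kappa] a supermodular function of a
    single set, so that [sort_levels] sorts both supports at once. *)
Definition pairset (S R : {set T}) : {set T + T} :=
  [set s | match s with inl e => e \in S | inr e => e \in R end].

Lemma pairset_inl S R : inl @^-1: pairset S R = S.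
Proof. by apply/setP => e; rewrite !inE. Qed.

Lemma pairset_inr S R : inr @^-1: pairset S R = R.
Proof. by apply/setP => e; rewrite !inE. Qed.

Definition compress m X := level (count_in m.+1 X).

Lemma compress_sub m X (B : {set T}) t :
  (forall s, X s \subset B) -> compress m X t \subset B.
Proof.
move=> XB; apply/subsetP => e; rewrite inE; apply: contraLR => eD.
rewrite -leqNgt /count_in big1 // => s _.
by rewrite (contraNF (subsetP (XB s) e) eD).
Qed.

(* X0 t, X1 t, X2 t are the sets of faces at the position of x_b-exponent t in
   (a, b)-degree N, N - 1, N - 2, where t is cyclic modulo m + 1. If N = e_b, then
   X0 0 and X0 N both have the full set D of faces, the two corresponding terms
   are merged, and [b = true]: the intersection of their supports replaces the
   last term of the first kind. *)
Definition cyclic_sum m (b : bool) (D : {set T}) X2 X1 X0 :=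
  \sum_(t < m) kappa (X2 t) (X1 t :&: X1 t.+1)
  + (if b then kappa (X1 0 :&: X1 m) D else kappa (X2 m) (X1 0 :&: X1 m))
  + (kappa (X1 0 :|: X1 m) (X0 0)
     + \sum_(t < m) kappa (X1 t.+1 :|: X1 t) (X0 t.+1)).

Lemma cyclic_sum_compress m b (D : {set T}) X2 X1 X0 : (forall t, X0 t \subset D) ->
  cyclic_sum m b D X2 X1 X0 <=
  cyclic_sum m b D (compress m X2) (compress m X1) (compress m X0).
Proof.
move=> X0D.
pose FR t (W : {set T + T}) := if b && (t == m) then kappa (inr @^-1: W) D
  else kappa (inl @^-1: W) (inr @^-1: W).
pose FU (t : nat) (W : {set T + T}) := kappa (inl @^-1: W) (inr @^-1: W).
pose xr t := pairset (X2 t) (if t == m then X1 0 :&: X1 m else X1 t :&: X1 t.+1).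
pose xu t := pairset (if t is t'.+1 then X1 t'.+1 :|: X1 t' else X1 0 :|: X1 m)
  (X0 t).
have -> : cyclic_sum m b D X2 X1 X0 =
    \sum_(t < m.+1) FR t (xr t) + \sum_(t < m.+1) FU t (xu t).
  rewrite /cyclic_sum; congr (_ + _).
    rewrite big_ord_recr; congr (_ + _).
      apply: eq_bigr => t _; rewrite /FR /xr.
      by rewrite (ltn_eqF (ltn_ord t)) andbF pairset_inl pairset_inr.
    by rewrite /FR /xr !eqxx andbT pairset_inl pairset_inr.
  rewrite big_ord_recl /FU /xu pairset_inl pairset_inr; congr (_ + _).
  by apply: eq_bigr => t _; rewrite pairset_inl pairset_inr.
have HR s t W W' : s < t < m.+1 ->
    FR s W + FR t W' <= FR s (W :|: W') + FR t (W :&: W').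
  move=> /andP[st tm]; rewrite /FR (ltn_eqF (leq_trans st tm)) andbF.
  rewrite !preimsetU !preimsetI; case: ifP => _.
    (* In the merged last term the intersection is the support of boundaries, not of cycles, so
       exchanging it with a support of cycles is a transfer; then the boundary support of the other
       term is enlarged by monotonicity. *)
    apply: leq_trans (rank_relcycles_transfer dd _ _ _ _) _.
    by rewrite leq_add2r dimvS // relcyclesS // subsetUl.
  exact: rank_relcycles_supermodular.
have HU s t W W' : s < t < m.+1 ->
    FU s W + FU t W' <= FU s (W :|: W') + FU t (W :&: W').
  move=> _; rewrite /FU !preimsetU !preimsetI.
  exact: rank_relcycles_supermodular.
apply: leq_trans (leq_add (sort_levels _ HR) (sort_levels _ HU)) _.
pose c e := count_in m.+1 X1 e.
pose p e := \sum_(t < m) ((e \in X1 t) && (e \in X1 t.+1))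
  + ((e \in X1 0) && (e \in X1 m)).
pose q e := ((e \in X1 0) || (e \in X1 m))
  + \sum_(t < m) ((e \in X1 t.+1) || (e \in X1 t)).
(* After sorting, [X2] and [X0] have their final form, but [X1] enters through the counts p and q.
   The compressed set occupies positions 0, ..., c - 1, which lie in c - 1 cyclic intersections and
   c + 1 cyclic unions, unless c is 0 or m + 1. *)
pose p' e := if c e == m.+1 then m.+1 else (c e).-1.
pose q' e := if c e == m.+1 then m.+1 else if c e == 0 then 0 else (c e).+1.
pose fr t (R : {set T}) := if b && (t == m) then kappa R D
  else kappa (compress m X2 t) R.
pose fu t (U : {set T}) := kappa U (compress m X0 t).
have Er (t : 'I_m.+1) : FR t (level (count_in m.+1 xr) t) = fr t (level p t).
  have -> : level (count_in m.+1 xr) t = pairset (compress m X2 t) (level p t).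
    apply/setP => -[e|e]; rewrite !inE; congr (_ < _).
      by apply: eq_bigr => s _; rewrite inE.
    rewrite /count_in /p big_ord_recr; congr (_ + _).
      apply: eq_bigr => s _; rewrite inE (ltn_eqF (ltn_ord s)).
      by rewrite inE.
    by rewrite inE eqxx inE.
  by rewrite /FR /fr pairset_inl pairset_inr.
have Eu (t : 'I_m.+1) : FU t (level (count_in m.+1 xu) t) = fu t (level q t).
  have -> : level (count_in m.+1 xu) t = pairset (level q t) (compress m X0 t).
    apply/setP => -[e|e]; rewrite !inE; congr (_ < _); last first.
      by apply: eq_bigr => s _; rewrite inE.
    rewrite /count_in /q big_ord_recl; congr (_ + _); first by rewrite !inE.
    by apply: eq_bigr => s _; rewrite !inE.
  by rewrite /FU /fu pairset_inl pairset_inr.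
under eq_bigr do rewrite Er; under [X in _ + X]eq_bigr do rewrite Eu.
have cm e : c e <= m.+1 by apply: count_in_le.
have -> : cyclic_sum m b D (compress m X2) (compress m X1) (compress m X0) =
    \sum_(t < m.+1) fr t (level p' t) + \sum_(t < m.+1) fu t (level q' t).
  rewrite /cyclic_sum; congr (_ + _).
    rewrite big_ord_recr; congr (_ + _).
      apply: eq_bigr => t _; rewrite /fr (ltn_eqF (ltn_ord t)) andbF.
      congr (kappa _ _); apply/setP => e; rewrite !inE -/(c e) /p'.
      by have := ltn_ord t; case: eqP => [->|] /=; lia.
    have -> : compress m X1 0 :&: compress m X1 m = level p' m.
      apply/setP => e; rewrite !inE -/(c e) /p'.
      by have := cm e; case: eqP => [->|] /=; lia.
    by rewrite /fr eqxx andbT.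
  rewrite big_ord_recl; congr (_ + _).
    rewrite /fu; congr (kappa _ _); apply/setP => e; rewrite !inE -/(c e) /q'.
    by have := cm e; case: eqP => [->|] /=; [|case: eqP => [->|] /=]; lia.
  apply: eq_bigr => t _; rewrite /fu; congr (kappa _ _); apply/setP => e.
  rewrite !inE -/(c e) /q' /= /bump /=; have := cm e; have := ltn_ord t.
  by case: eqP => [->|] /=; [|case: eqP => [->|] /=]; lia.
apply: transfer_levels => [i j R U|e].
  rewrite /fr /fu; case: ifP => _.
    (* For the merged term both sets are boundary supports, so supermodularity replaces the
       transfer; the supports of cycles do not change because one contains the other. *)
    apply: leq_trans (rank_relcycles_supermodular _ _ _ _ _) _.
    have XD : compress m X0 j \subset D by apply: compress_sub.
    by rewrite (setUidPl XD) (setIidPr XD).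
  exact: rank_relcycles_transfer.
have /= := cyclic_counts m (fun t => e \in X1 t).
rewrite -/(q e) -/(p e) -[\sum_(t < m.+1) _]/(c e) => -[E1 E2].
have qm : q e <= m.+1.
  by rewrite /q -add1n leq_add ?leq_b1 // sum_bool_leq.
have := cm e; rewrite /p' /q'; move: (c e) (p e) (q e) E1 E2 qm => c0 p0 q0.
by case: eqP => [->|]; [|case: eqP => [->|]] => *; split; lia.
Qed.

End CyclicCompression.

(** * The sum over a fibre, for N below, equal to and above e_b *)

Section FibreSum.
Variables (k : fieldType) (T : finType).
Local Notation V := {ffun T -> k^o}.
Variable d : 'End(V).
Hypothesis dd : forall v, d (d v) = 0%R.
Implicit Types (X Y Z : nat -> {set T}) (B : {set T}).

Local Notation kappa := (rank_relcycles d).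

(** A face containing b in a multidegree of x_b-exponent t leaves a monomial of x_b-exponent t - 1;
    for t = 0 there is no such face. *)
Definition shift X t := if t is t'.+1 then X t' else set0.

Definition fibre_sum N X2 X1 X0 :=
  \sum_(t < N.+1) (kappa (X1 t :|: shift X1 t) (X0 t) +
                   kappa (shift X2 t) (X1 t :&: shift X1 t)).

Lemma rank_relcycles0 : kappa set0 set0 = 0.
Proof.
apply/eqP; rewrite -leqn0; apply: leq_trans (dimvS (capvSl _ _)) _.
by rewrite dim_coords cards0.
Qed.

Lemma fibre_sumE N X2 X1 X0 : fibre_sum N X2 X1 X0 =
  kappa (X1 0) (X0 0) +
  \sum_(t < N) (kappa (X1 t.+1 :|: X1 t) (X0 t.+1) +
                kappa (X2 t) (X1 t.+1 :&: X1 t)).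
Proof.
rewrite /fibre_sum big_ord_recl /=; congr (_ + _).
by rewrite setU0 setI0 rank_relcycles0 addn0.
Qed.

Lemma compress_full m X B : (forall s, X s \subset B) -> X 0 = B ->
  compress m X 0 = B.
Proof.
move=> XB X0; apply/eqP; rewrite eqEsubset compress_sub //=.
by apply/subsetP => e eB; rewrite inE /count_in big_ord_recl X0 eB.
Qed.

Lemma compress_last m X : X m = set0 -> compress m X m = set0.
Proof.
move=> Xm; apply/setP => e; rewrite !inE /count_in big_ord_recr /= Xm inE addn0.
by rewrite ltnNge count_in_le.
Qed.

Lemma compressS m X s t : s <= t -> compress m X t \subset compress m X s.
Proof. by move=> st; apply/subsetP => e; rewrite !inE; apply: leq_ltn_trans. Qed.

Lemma eq_cyclic_sum m b B X2 X1 X0 Y2 Y1 Y0 :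
  (forall t, t <= m -> [/\ X2 t = Y2 t, X1 t = Y1 t & X0 t = Y0 t]) ->
  cyclic_sum d m b B X2 X1 X0 = cyclic_sum d m b B Y2 Y1 Y0.
Proof.
move=> E; have [_ E10 E00] := E 0 (leq0n m).
have [E2m E1m _] := E m (leqnn m).
rewrite /cyclic_sum E10 E00 E2m E1m.
congr (_ + _ + (_ + _)); apply: eq_bigr => t _.
  by have [-> -> _] := E t (ltnW (ltn_ord t)); have [_ -> _] := E t.+1 (ltn_ord t).
by have [_ -> _] := E t (ltnW (ltn_ord t)); have [_ -> ->] := E t.+1 (ltn_ord t).
Qed.

Lemma fibre_sum_cyclic N X2 X1 X0 B : X1 N = set0 -> X2 N = set0 ->
  fibre_sum N X2 X1 X0 = cyclic_sum d N false B X2 X1 X0.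
Proof.
move=> e1 e2; rewrite fibre_sumE /cyclic_sum e1 e2 setI0 setU0 rank_relcycles0 addn0.
rewrite [RHS]addnCA; congr (_ + _); rewrite big_split addnC.
by congr (_ + _); apply: eq_bigr => t _; rewrite setIC.
Qed.

(** The two terms put in front are those that [cyclic_sum] contains only in merged form. *)
Lemma fibre_sum_last m X2 X1 X0 : X1 m.+1 = set0 -> X2 m = set0 ->
  fibre_sum m.+1 X2 X1 X0 =
  kappa (X1 0) (X0 0) + kappa (X1 m) (X0 m.+1) +
  (\sum_(t < m) kappa (X2 t) (X1 t :&: X1 t.+1)
   + \sum_(t < m) kappa (X1 t.+1 :|: X1 t) (X0 t.+1)).
Proof.
move=> e1 e2; rewrite fibre_sumE big_ord_recr /= e1 e2 set0I set0U rank_relcycles0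
  addn0.
rewrite [in LHS]addnA addnAC; congr (_ + _); rewrite big_split addnC.
by congr (_ + _); apply: eq_bigr => t _; rewrite setIC.
Qed.

(** In their union and intersection with [X1 m], both [X1 m.+1] and [X1 0] act as full sets, so the
    neighbour m + 1 of m may be replaced by 0. This closes the cycle and separates it from the
    positions that compression leaves alone. *)
Lemma fibre_sum_split N m X2 X1 X0 B : m.+1 < N -> X1 m \subset X1 0 ->
  X1 m \subset X1 m.+1 ->
  fibre_sum N X2 X1 X0 = cyclic_sum d m false B X2 X1 X0
  + (kappa (X1 m.+1) (X0 m.+1)
     + \sum_(m.+1 <= t < N) (kappa (X1 t.+1 :|: X1 t) (X0 t.+1) +
                kappa (X2 t) (X1 t.+1 :&: X1 t))).
Proof.
move=> mN s0 sS; rewrite fibre_sumE /cyclic_sum.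
rewrite -(big_mkord xpredT (fun t => kappa (X1 t.+1 :|: X1 t) (X0 t.+1) +
                kappa (X2 t) (X1 t.+1 :&: X1 t))).
rewrite (big_cat_nat (n := m.+1)) //=; last exact: ltnW.
rewrite big_nat_recr //= big_mkord big_split /=.
rewrite (setIidPr s0) (setUidPl s0) (setIidPr sS) (setUidPl sS).
have -> : \sum_(t < m) kappa (X2 t) (X1 t.+1 :&: X1 t) =
  \sum_(t < m) kappa (X2 t) (X1 t :&: X1 t.+1).
  by apply: eq_bigr => t _; rewrite setIC.
by ring.
Qed.

(* m + 1 is the number of x_b-exponents subject to compression; the cases
   m = N, m + 1 = N, m + 1 < N correspond to N < e_b, N = e_b, N > e_b. *)
Lemma fibre_sum_compress N m X2 X1 X0 Y2 Y1 Y0 B1 B0 : m <= N ->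
  (forall t, N <= t -> X1 t = set0) -> (forall t, N <= t.+1 -> X2 t = set0) ->
  (forall t, X1 t \subset B1) -> (forall t, X0 t \subset B0) ->
  (m < N -> X0 0 = B0 /\ X0 m.+1 = B0) ->
  (m.+1 < N -> X1 0 = B1 /\ X1 m.+1 = B1) ->
  (forall t, t <= m -> [/\ Y2 t = compress m X2 t, Y1 t = compress m X1 t
                         & Y0 t = compress m X0 t]) ->
  (forall t, m < t -> [/\ Y2 t = X2 t, Y1 t = X1 t & Y0 t = X0 t]) ->
  fibre_sum N X2 X1 X0 <= fibre_sum N Y2 Y1 Y0.
Proof.
move=> mN e1 e2 X1B X0B f0 f1 low high.
have cyc b : cyclic_sum d m b B0 X2 X1 X0 <= cyclic_sum d m b B0 Y2 Y1 Y0.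
  by rewrite (eq_cyclic_sum _ _ low) cyclic_sum_compress.
have [Nm|ltmN] := leqP N m.
  have {mN Nm} E : m = N by apply/eqP; rewrite eqn_leq mN.
  have [l2 l1 _] := low m (leqnn m); rewrite -E.
  rewrite (fibre_sum_cyclic X0 B0) ?(fibre_sum_cyclic Y0 B0) // ?l1 ?l2.
  - by apply: compress_last; rewrite E e1.
  - by apply: compress_last; rewrite E e2.
  - by rewrite E e1.
  - by rewrite E e2.
have [X00 X0m] := f0 ltmN.
have [l2m l1m _] := low m (leqnn m).
have [_ l10 l00] := low 0 (leq0n m).
have [h2 h1 h0] := high m.+1 (ltnSn m).
have [NSm|ltmSN] := leqP N m.+1.
  have {NSm mN ltmN} E : m.+1 = N by apply/eqP; rewrite eqn_leq ltmN.
  have x2 : X2 m = set0 by rewrite e2 // E.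
  have x1 : X1 m.+1 = set0 by rewrite e1 // E.
  rewrite -E !fibre_sum_last ?h1 // ?l2m ?compress_last //.
  rewrite h0 X0m l00 (compress_full m X0B X00) X00.
  have := cyc true; rewrite /cyclic_sum l00 (compress_full m X0B X00).
  have -> : Y1 0 :&: Y1 m = Y1 m by apply/setIidPr; rewrite l10 l1m compressS.
  have -> : Y1 0 :|: Y1 m = Y1 0 by apply/setUidPl; rewrite l10 l1m compressS.
  rewrite X00 => cyc1.
  (* Merging the two terms with full cycle support can only increase the sum; for Y it changes
     nothing, since [Y1 m] is contained in [Y1 0]. *)
  have := rank_relcycles_supermodular d (X1 0) B0 (X1 m) B0.
  rewrite setUid setIid; move: cyc1; lia.
have [X10 X1m] := f1 ltmSN.
rewrite (fibre_sum_split _ _ B0 ltmSN) ?X10 ?X1m //.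
rewrite (fibre_sum_split _ _ B0 ltmSN); first last.
- by rewrite h1 X1m l1m compress_sub.
- by rewrite l10 l1m compressS.
rewrite leq_add // h1 h0 X1m leq_add2l.
rewrite [leqLHS]big_nat_cond [leqRHS]big_nat_cond; apply: eq_leq.
apply: eq_bigr => t /andP[/andP[mt _] _].
have [-> -> _] := high t mt; have [_ -> ->] := high t.+1 (ltnW mt).
by [].
Qed.

End FibreSum.

(** * The Koszul differential *)

Section Contractions.
Local Open Scope ring_scope.
Variables (k : fieldType) (n : nat).
Local Notation V := {ffun {set 'I_n} -> k^o}.
Implicit Types (p q : 'I_n) (C F : {set 'I_n}) (v w : V).

(** Contraction against the p-th basis vector of the exterior algebra; [wedge] is multiplication by
    that vector. Scalars suffice, because in a fixed multidegree the face determines the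
    monomial. *)
Definition contract p v : V :=
  [ffun C : {set 'I_n} => if p \in C then 0 else (-1) ^+ kpos p C *: v (p |: C)].

Definition wedge p v : V :=
  [ffun C : {set 'I_n} => if p \in C then (-1) ^+ kpos p C *: v (C :\ p) else 0].

Fact contract_is_linear p : linear (contract p).
Proof.
move=> c u v; apply/ffunP => C; rewrite !ffunE.
case: ifP => _; first by rewrite scaler0 addr0.
by rewrite scalerDr !scalerA [c * _]mulrC.
Qed.
HB.instance Definition _ p :=
  GRing.isLinear.Build k V V _ (contract p) (contract_is_linear p).

Lemma sign_mulN (a b c e : nat) : odd a (+) odd b = ~~ (odd c (+) odd e) ->
  (-1) ^+ a * (-1) ^+ b = - ((-1) ^+ c * (-1) ^+ e) :> k.
Proof.
move=> E; rewrite -!exprD -[RHS]mulN1r -exprS -signr_odd oddD E.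
by rewrite -[RHS]signr_odd /= oddD.
Qed.

(** Exactly one of p < q and q < p holds, so adding the other element moves exactly one of the two
    positions. This is the sign in all anticommutation rules below. *)
Lemma odd_kpos p q C : p != q -> p \notin C -> q \notin C ->
  odd (kpos q (p |: C)) =
  ~~ (odd (kpos p (q |: C)) (+) odd (kpos q C) (+) odd (kpos p C)).
Proof.
wlog ltpq : p q / (p < q)%N => [H pq pC qC|_ pC qC].
  case: (ltngtP p q) => [lt|lt|/val_inj e]; first exact: H.
    rewrite [in RHS]H // 1?eq_sym //.
    by do 3!case: (odd _).
  by rewrite e eqxx in pq.
rewrite kposU ?pC; last by rewrite leqNgt ltpq.
rewrite kposU_le ?(ltnW ltpq) // addn1 /=.
by do 2!case: (odd _).
Qed.

Lemma kpos_setU1 p C : kpos p (p |: C) = kpos p C.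
Proof. exact: kposU_le. Qed.

Lemma contract2 p v : contract p (contract p v) = 0.
Proof. by apply/ffunP => C; rewrite !ffunE setU11 scaler0 if_same. Qed.

Lemma contractC p q v : p != q ->
  contract p (contract q v) = - contract q (contract p v).
Proof.
move=> pq; apply/ffunP => C; rewrite !ffunE !inE [q == p]eq_sym (negPf pq) /=.
have [pC|pC] /= := boolP (p \in C).
  by case: ifP => _; rewrite ?scaler0 oppr0.
have [qC|qC] /= := boolP (q \in C); first by rewrite scaler0 oppr0.
rewrite !scalerA -scaleNr setUCA; congr (_ *: _).
apply: sign_mulN; rewrite (@odd_kpos p q) //.
by do 3!case: (odd _).
Qed.

Lemma contract_wedge p v : contract p (wedge p v) =
  [ffun C : {set 'I_n} => if p \in C then 0 else v C].
Proof.
apply/ffunP => C; rewrite !ffunE setU11 kpos_setU1; case: ifPn => // pC.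
by rewrite scalerA -expr2 sqrr_sign scale1r setU1K.
Qed.

Lemma contract_wedgeC p q v : p != q ->
  contract p (wedge q v) = - wedge q (contract p v).
Proof.
move=> pq; apply/ffunP => C; rewrite !ffunE !inE [q == p]eq_sym (negPf pq) /=.
have [pC|pC] /= := boolP (p \in C).
  by case: ifP => _; rewrite ?scaler0 oppr0.
have [qC|qC] /= := boolP (q \in C); last by rewrite scaler0 oppr0.
have -> : (p |: C) :\ q = p |: C :\ q.
  apply/setP => r; rewrite !inE.
  by case: (eqVneq r p) => [->|_] //=; rewrite pq.
have pD : p \notin C :\ q by rewrite !inE (negPf pC) andbF.
rewrite !scalerA -scaleNr; congr (_ *: _).
rewrite -[in LHS](setD1K qC) setUCA kpos_setU1.
rewrite -[in RHS](setD1K qC) kpos_setU1 setU1K ?setD11 //.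
apply: sign_mulN; rewrite (@odd_kpos p q) ?setD11 //.
by do 3!case: (odd _).
Qed.

Definition bdy (Q : pred 'I_n) : 'End(V) := \sum_(q | Q q) linfun (contract q).

Lemma bdyE Q v : bdy Q v = \sum_(q | Q q) contract q v.
Proof. by rewrite sum_lfunE; apply: eq_bigr => q _; rewrite lfunE. Qed.

Lemma contract_bdy Q p v : ~~ Q p -> contract p (bdy Q v) = - bdy Q (contract p v).
Proof.
move=> Qp; rewrite !bdyE raddf_sum -sumrN; apply: eq_bigr => q Qq /=.
by rewrite contractC //; apply: contraNneq Qp => ->.
Qed.

Lemma bdy_wedge Q p v : ~~ Q p -> bdy Q (wedge p v) = - wedge p (bdy Q v).
Proof.
move=> Qp; rewrite !bdyE.
have -> : wedge p (\sum_(q | Q q) contract q v) =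
    \sum_(q | Q q) wedge p (contract q v).
  apply/ffunP => C; rewrite ffunE !sum_ffunE; case: ifP => pC.
    by rewrite scaler_sumr; apply: eq_bigr => q _; rewrite [RHS]ffunE pC.
  by rewrite big1 // => q _; rewrite ffunE pC.
rewrite -sumrN; apply: eq_bigr => q Qq.
by rewrite contract_wedgeC //; apply: contraNneq Qp => <-.
Qed.

Lemma bdy_bdy Q v : bdy Q (bdy Q v) = 0.
Proof.
have E : bdy Q (bdy Q v) = \sum_(p | Q p) \sum_(q | Q q && (p < q)%N)
    (contract p (contract q v) + contract q (contract p v)).
  rewrite bdyE; under eq_bigr do rewrite bdyE raddf_sum.
  under [RHS]eq_bigr do rewrite big_split /=.
  rewrite big_split /= [X in _ = _ + X](exchange_big_dep Q) /=; last first.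
    by move=> p q _ /andP[].
  rewrite -big_split; apply: eq_bigr => p Qp /=.
  rewrite (bigD1 p) //= contract2 add0r (bigID (fun q => (p < q)%N)) /=.
  congr (_ + _); apply: eq_bigl => q.
    by case: (Q q) => //=; rewrite -(inj_eq val_inj) /=; case: ltngtP.
  by rewrite Qp -(inj_eq val_inj) /=; case: (Q q) => //=; case: ltngtP.
rewrite E big1 // => p _; rewrite big1 // => q /andP[_ ltpq].
by rewrite contractC ?addNr // -(inj_eq val_inj) /= (ltn_eqF ltpq).
Qed.

End Contractions.

Lemma dimv_le_inj (k : fieldType) (aT rT : vectType k) (f : 'Hom(aT, rT))
    (U : {vspace aT}) (W : {vspace rT}) :
  (U :&: lker f)%VS = 0%VS -> (f @: U <= W)%VS -> (\dim U <= \dim W)%N.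
Proof. by move=> /limg_dim_eq <-; apply: dimvS. Qed.

(** * Cycles split along two variables *)

Section Split.
Local Open Scope ring_scope.
Variables (k : fieldType) (n : nat) (a b : 'I_n).
Hypothesis ab : a != b.
Local Notation V := {ffun {set 'I_n} -> k^o}.
Implicit Types (p q : 'I_n) (C F : {set 'I_n}) (K : {set {set 'I_n}}) (v w : V).

Definition rank_cycles (K : {set {set 'I_n}}) :=
  \dim (coords k K :&: lker (bdy k predT))%VS.

Definition others : pred 'I_n := [pred q | (q != a) && (q != b)].

Definition meets_ab : {set {set 'I_n}} :=
  [set F : {set 'I_n} | (a \in F) || (b \in F)].

Definition slice0 (K : {set {set 'I_n}}) := K :\: meets_ab.
Definition slice1 p (K : {set {set 'I_n}}) :=
  [set F : {set 'I_n} | p |: F \in K] :\: meets_ab.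
Definition slice2 (K : {set {set 'I_n}}) :=
  [set F : {set 'I_n} | a |: (b |: F) \in K] :\: meets_ab.

Local Notation kappa := (rank_relcycles (bdy k others)).
Local Notation d0 := (bdy k others).
Local Notation r := (off meets_ab).

Lemma bdyT v : bdy k predT v = d0 v + contract a v + contract b v.
Proof.
rewrite !bdyE (bigD1 a) //= (bigD1 b) //=; last by rewrite eq_sym.
by rewrite addrA addrC addrA.
Qed.

Lemma off_bdy v : r (d0 v) = d0 (r v).
Proof.
rewrite !bdyE; apply/ffunP => C; rewrite ffunE !sum_ffunE.
case: ifPn => CW.
  rewrite big1 // => q Qq; rewrite !ffunE; case: ifP => // _.
  move: CW; rewrite !inE => /orP[->|->]; rewrite ?orbT; exact: scaler0.
apply: eq_bigr => q /andP[qa qb]; rewrite !ffunE !inE.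
move: CW; rewrite inE negb_or => /andP[/negPf -> /negPf ->].
by rewrite !orbF eq_sym (negPf qa) eq_sym (negPf qb).
Qed.

Lemma off_coords K v : v \in coords k K -> r v \in coords k (slice0 K).
Proof.
move=> /coordsP h; apply/coordsP => C; rewrite ffunE inE negb_and negbK.
by case: ifP => //= _; apply: h.
Qed.

Lemma off_contract_coords K p v : p \in [:: a; b] -> v \in coords k K ->
  r (contract p v) \in coords k (slice1 p K).
Proof.
move=> pab /coordsP h; apply/coordsP => C; rewrite !ffunE in_setD negb_and negbK.
case: ifPn => //= CW; rewrite inE => pK.
case: ifP => // _; by rewrite h ?scaler0.
Qed.

Lemma off_contract2_coords K v : v \in coords k K ->
  r (contract a (contract b v)) \in coords k (slice2 K).
Proof.
move=> /coordsP h; apply/coordsP => C; rewrite !ffunE in_setD negb_and negbK.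
case: ifPn => //= CW; rewrite inE => pK.
rewrite !inE in CW *; rewrite eq_sym (negPf ab) /=; case: ifP => // _.
by case: ifP => _; rewrite ?scaler0 // setUCA h // !scaler0.
Qed.

(* A cycle is determined by its components at F and a |: F, for F without a and
   b; the component at b |: F is minus the sum of the other one and of the
   boundary of the first. *)
Lemma rank_cycles_le K :
  (rank_cycles K <= kappa (slice1 a K :|: slice1 b K) (slice0 K) +
                    kappa (slice2 K) (slice1 a K :&: slice1 b K))%N.
Proof.
pose f : 'End(V) := linfun r; pose g : 'End(V) := (f \o linfun (contract a))%VF.
have fE v : f v = r v by rewrite lfunE.
have gE v : g v = r (contract a v) by rewrite comp_lfunE fE lfunE.
set Q := (coords k K :&: lker (bdy k predT))%VS.
have QP v : v \in Q -> v \in coords k K /\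
    d0 (r v) = - r (contract a v) - r (contract b v).
  rewrite memv_cap (memv_ker (bdy k predT)) => /andP[vK /eqP].
  rewrite bdyT -addrA => /eqP; rewrite addr_eq0 => /eqP E; split=> //.
  by rewrite -off_bdy E !raddfN raddfD opprD.
rewrite /rank_cycles -/Q -(limg_ker_dim f Q) addnC leq_add //.
  apply: dimvS; apply/subvP => _ /memv_imgP[v /QP[vK E] ->]; rewrite fE.
  apply/relcyclesP; split; first exact: off_coords.
  rewrite E coordsU memv_add // memvN; apply: off_contract_coords => //;
    by rewrite !inE eqxx ?orbT.
(* If the component free of a and b vanishes, the components at a and at b are opposite, hence
   supported on both slices; contracting the cycle equation with a identifies the boundary with the
   component at both a and b. *)
have KP v : v \in (Q :&: lker f)%VS ->
    [/\ v \in coords k K, r v = 0, r (contract b v) = - r (contract a v)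
      & d0 (r (contract a v)) = r (contract a (contract b v))].
  rewrite memv_cap (memv_ker f) fE => /andP[vQ /eqP rv0].
  have [vK E] := QP v vQ; split=> //.
    by move: E; rewrite rv0 raddf0 => /eqP; rewrite eq_sym subr_eq0 => /eqP.
  move: vQ; rewrite memv_cap (memv_ker (bdy k predT)) bdyT => /andP[_].
  rewrite -addrA addr_eq0 => /eqP E'.
  have oa : ~~ others a by rewrite /others /= eqxx.
  rewrite -off_bdy -[d0 (contract a v)]opprK -contract_bdy // E'.
  by rewrite !raddfN opprK raddfD /= contract2 add0r.
rewrite /rank_relcycles; apply: (@dimv_le_inj _ _ _ g).
  apply/eqP; rewrite -subv0; apply/subvP => v.
  rewrite memv_cap (memv_ker g) gE => /andP[/KP[vK rv0 E1 E2] /eqP E3].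
  move: E1 E2; rewrite E3 oppr0 raddf0 => E1 /esym E2.
  rewrite memv0; apply/eqP/ffunP => C; rewrite ffunE.
  have z F : a \notin F -> b \notin F ->
      [/\ v F = 0, v (a |: F) = 0, v (b |: F) = 0 & v (a |: (b |: F)) = 0].
    move=> aF bF; move/ffunP/(_ F): rv0; move/ffunP/(_ F): E1.
    move/ffunP/(_ F): E2; move/ffunP/(_ F): E3.
    rewrite !ffunE !inE [b == a]eq_sym (negPf ab) (negPf aF) (negPf bF) /=.
    have sg m (x : k^o) : (-1) ^+ m *: x = 0 -> x = 0.
      by move=> /eqP; rewrite scaler_eq0 signr_eq0 => /eqP.
    by move=> /sg -> /sg/sg + /sg -> ->; rewrite setUCA => ->.
  have [aC|aC] := boolP (a \in C); have [bC|bC] := boolP (b \in C).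
  - have := z ((C :\ a) :\ b); rewrite !inE !eqxx (negPf ab) andbF => -[] // _ _ _.
    by rewrite setD1K ?setD1K // !inE bC eq_sym ab.
  - have := z (C :\ a); rewrite !inE eqxx (negPf bC) andbF => -[] // _.
    by rewrite setD1K.
  - have := z (C :\ b); rewrite !inE eqxx (negPf aC) andbF => -[] // _ _.
    by rewrite setD1K.
  - by have [] := z C aC bC.
apply/subvP => _ /memv_imgP[v /KP[vK rv0 E1 E2] ->]; rewrite gE.
apply/relcyclesP; rewrite E2 coordsI memv_cap off_contract2_coords //.
rewrite off_contract_coords ?inE ?eqxx //= -[r (contract a v)]opprK -E1 memvN.
by rewrite off_contract_coords ?inE ?eqxx ?orbT.
Qed.

Lemma contract_supp p v : (forall C, p \in C -> v C = 0) -> contract p v = 0.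
Proof.
move=> h; apply/ffunP => C; rewrite !ffunE h ?setU11 // scaler0; exact: if_same.
Qed.

Lemma contract_wedge_supp p v : (forall C, p \in C -> v C = 0) ->
  contract p (wedge p v) = v.
Proof.
by move=> h; rewrite contract_wedge; apply/ffunP => C; rewrite ffunE;
  case: ifP => // /h ->.
Qed.

Lemma slice_supp (S : {set {set 'I_n}}) v p C : v \in coords k (S :\: meets_ab) ->
  p \in [:: a; b] -> p \in C -> v C = 0.
Proof.
move=> /coordsP h; rewrite !inE => pab pC; apply: h; rewrite !inE.
by case/orP: pab => /eqP <-; rewrite pC ?orbT.
Qed.

Lemma off_id (S : {set {set 'I_n}}) v : v \in coords k (S :\: meets_ab) -> r v = v.
Proof.
move=> /coordsP h; apply/ffunP => C; rewrite ffunE; case: ifP => // CW.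
by rewrite h // in_setD CW.
Qed.

Lemma off_wedge p v : p \in [:: a; b] -> r (wedge p v) = 0.
Proof.
move=> pab; apply/ffunP => C; rewrite !ffunE !inE.
case: ifPn => //; rewrite negb_or => /andP[/negPf aC /negPf bC].
by move: pab; rewrite !inE => /orP[] /eqP ->; rewrite ?aC ?bC.
Qed.

Lemma wedge_coords K p v : p \in [:: a; b] -> v \in coords k (slice1 p K) ->
  wedge p v \in coords k K.
Proof.
move=> pab /coordsP h; apply/coordsP => C CK; rewrite ffunE; case: ifP => // pC.
by rewrite h ?scaler0 // !inE setD1K // (negPf CK) andbF.
Qed.

Lemma wedge0 p : wedge p (0 : V) = 0.
Proof. by apply/ffunP => C; rewrite !ffunE scaler0 if_same. Qed.

(** When the slices are nested, their union is the slice of one variable p, so every relative cycle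
    extends to a cycle by correction terms that stay supported on K. *)
Lemma rank_cycles_ge K :
  (slice1 a K \subset slice1 b K) || (slice1 b K \subset slice1 a K) ->
  (kappa (slice1 a K :|: slice1 b K) (slice0 K) +
   kappa (slice2 K) (slice1 a K :&: slice1 b K) <= rank_cycles K)%N.
Proof.
move=> comp.
have [p pab EU] : exists2 p, p \in [:: a; b] &
    slice1 a K :|: slice1 b K = slice1 p K.
  case/orP: comp => /setUidPr h; first by exists b; rewrite // !inE eqxx orbT.
  by exists a; rewrite ?inE ?eqxx // setUC.
have [oa ob] : ~~ others a /\ ~~ others b by rewrite /others /= !eqxx andbF.
have op : ~~ others p by move: pab; rewrite !inE => /orP[] /eqP ->.
pose f : 'End(V) := linfun r; pose g : 'End(V) := (f \o linfun (contract a))%VF.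
have fE v : f v = r v by rewrite lfunE.
have gE v : g v = r (contract a v) by rewrite comp_lfunE fE lfunE.
set Q := (coords k K :&: lker (bdy k predT))%VS.
have QP v : v \in coords k K -> bdy k predT v = 0 -> v \in Q.
  by move=> vK dv; rewrite memv_cap vK (memv_ker (bdy k predT)) dv eqxx.
rewrite /rank_cycles -/Q -(limg_ker_dim f Q) addnC leq_add //; last first.
  apply: dimvS; apply/subvP => z /relcyclesP[zZ]; rewrite EU => dz.
  have zs q : q \in [:: a; b] -> contract q z = 0.
    by move=> qab; apply: contract_supp => C qC; apply: slice_supp zZ qab qC.
  (* Contracting the correction with p cancels [d0 z], and its own [d0] vanishes because boundaries
     are cycles. *)
  have -> : z = f (z - wedge p (d0 z)).
    by rewrite fE raddfB /= off_wedge // subr0 (off_id zZ).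
  apply/memv_img/QP.
    rewrite rpredB ?wedge_coords //; apply: subvP zZ.
    by apply: coordsS; apply: subsetDl.
  have cp q : q \in [:: a; b] ->
      contract q (wedge p (d0 z)) = if q == p then d0 z else 0.
    move=> qab; case: eqVneq => [->|qp].
      by rewrite contract_wedge_supp // => C pC; apply: slice_supp dz pab pC.
    rewrite contract_wedgeC // contract_bdy ?zs ?raddf0 ?oppr0 ?wedge0 ?oppr0 //.
    by move: qab; rewrite !inE => /orP[] /eqP ->.
  rewrite bdyT raddfB /= bdy_wedge // bdy_bdy wedge0 oppr0 subr0.
  rewrite !raddfB /= !zs ?cp ?inE ?eqxx ?orbT // !sub0r.
  move: pab; rewrite !inE => /orP[] /eqP ->; rewrite eqxx.
    by rewrite eq_sym (negPf ab) oppr0 addr0 subrr.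
  by rewrite (negPf ab) oppr0 addr0 subrr.
apply: (@leq_trans (\dim (g @: (Q :&: lker f)))); last first.
  by rewrite -[leqRHS](limg_ker_dim g) leq_addl.
apply: dimvS; apply/subvP => y /relcyclesP[]; rewrite coordsI memv_cap.
move=> /andP[yA yB] dy; set x := d0 y in dy.
have yab q C : q \in [:: a; b] -> q \in C -> y C = 0.
  by apply: slice_supp; exact: yA.
have xab q C : q \in [:: a; b] -> q \in C -> x C = 0.
  by apply: slice_supp; exact: dy.
have [aab bab] : a \in [:: a; b] /\ b \in [:: a; b] by rewrite !inE !eqxx orbT.
have wx C : a \in C -> wedge b x C = 0.
  move=> aC; rewrite ffunE; case: ifP => // bC.
  by rewrite (xab a) ?scaler0 // !inE aC ab.
(* The copies of y at a and b cancel under the two contractions. What remains is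
   [wedge a x - wedge b x], the negative of [d0 w]. *)
pose w := wedge a y - wedge b y - wedge a (wedge b x).
have ca : contract a w = y - wedge b x.
  rewrite !raddfB /= contract_wedge_supp => [|C]; last exact: yab.
  rewrite contract_wedgeC // contract_supp => [|C]; last exact: yab.
  by rewrite wedge0 oppr0 subr0 contract_wedge_supp.
have cb : contract b w = wedge a x - y.
  rewrite !raddfB /= contract_wedgeC 1?eq_sym // contract_supp => [|C]; last exact: yab.
  rewrite wedge0 oppr0 sub0r contract_wedge_supp => [|C]; last exact: yab.
  rewrite contract_wedgeC 1?eq_sym // contract_wedge_supp => [|C]; last exact: xab.
  by rewrite opprK addrC.
have -> : y = g w.
  by rewrite gE ca raddfB /= off_wedge // subr0 (off_id yA).
apply: memv_img; rewrite memv_cap (memv_ker f) fE !raddfB /= !off_wedge // !subr0.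
rewrite eqxx andbT; apply: QP.
  rewrite rpredB //; first by rewrite rpredB ?wedge_coords.
  apply/coordsP => C CK; rewrite !ffunE.
  case: ifP => // aC; case: ifP => [bC|]; rewrite ?scaler0 //.
  have E : a |: (b |: (C :\ a) :\ b) = C by rewrite setD1K ?setD1K.
  by move/coordsP: dy => ->; rewrite ?scaler0 // !inE E (negPf CK) andbF.
rewrite bdyT ca cb !raddfB /= !bdy_wedge // -/x bdy_bdy !wedge0 !oppr0 wedge0 oppr0
  subr0.
have E (A B Y : V) : - A + B + (Y - B) + (A - Y) = 0.
  rewrite [- A + B + _]addrC [- A + B]addrC [Y - B + _]addrA subrK.
  by rewrite addrA subrK subrr.
by rewrite opprK E.
Qed.

End Split.

(** * Compression *)

Lemma card_link (T : finType) p (K : {set {set T}}) :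
  #|K| = #|[set F in K | p \notin F]| +
         #|[set F : {set T} | (p |: F \in K) && (p \notin F)]|.
Proof.
rewrite -(cardsID [set F : {set T} | p \in F] K) addnC; congr (_ + _).
  by apply: eq_card => F; rewrite !inE andbC.
rewrite -[RHS](card_in_imset (f := fun F => p |: F)); last first.
  move=> F G; rewrite !inE => /andP[_ pF] /andP[_ pG] E.
  by rewrite -(setU1K pF) E setU1K.
apply: eq_card => C; rewrite !inE; apply/andP/imsetP => [[CK pC]|[F]].
  by exists (C :\ p); rewrite ?setD1K // !inE setD1K // CK eqxx.
by rewrite !inE => /andP[FK _] ->; rewrite FK setU11.
Qed.

Lemma card_slices n (a b : 'I_n) (K : {set {set 'I_n}}) : a != b ->
  #|K| = #|slice0 a b K| + #|slice1 a b a K| +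
         (#|slice1 a b b K| + #|slice2 a b K|).
Proof.
move=> ab; rewrite (card_link a).
rewrite [X in X + _ = _](card_link b) [X in _ + X = _](card_link b).
rewrite addnACA; congr (_ + _ + (_ + _)); apply: eq_card => F;
  rewrite !inE ?negb_or ?(negPf ab) /=; case: (a \in F); case: (b \in F);
  by rewrite ?andbF ?andbT.
Qed.

(** * Faces in a multidegree and along a fibre *)

Section Faces.
Variable n : nat.
Implicit Types (U : pred 'X_{1..n}) (m mu : 'X_{1..n}) (C F : {set 'I_n}).

Definition mnm_ind C : 'X_{1..n} := [multinom nat_of_bool (i \in C) | i < n].

(** These index the basis x^(mu - C) e_C of the multidegree mu part of the i-th Koszul module
    tensored with the ideal spanned by U. *)
Definition faces U i mu : {set {set 'I_n}} :=
  [set C : {set 'I_n} | [&& #|C| == i, (mnm_ind C <= mu)%MM & U (mu - mnm_ind C)%MM]].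

End Faces.

Section Fibre.
Variables (n : nat) (a b : 'I_n).
Hypothesis ab : a != b.
Implicit Types (U : pred 'X_{1..n}) (m mu nu : 'X_{1..n}) (C F : {set 'I_n}).

Definition setab m s t : 'X_{1..n} :=
  [multinom if i == a then s else if i == b then t else m i | i < n].

Lemma setab_a m s t : setab m s t a = s.
Proof. by rewrite mnmE eqxx. Qed.

Lemma setab_b m s t : setab m s t b = t.
Proof. by rewrite mnmE eq_sym (negPf ab) eqxx. Qed.

Lemma setab_id m : setab m (m a) (m b) = m.
Proof.
by apply/mnmP => q; rewrite mnmE; case: eqP => [->|_] //; case: eqP => [->|].
Qed.

Lemma setab_setab m s t s' t' : setab (setab m s t) s' t' = setab m s' t'.
Proof. by apply/mnmP => q; rewrite !mnmE; case: eqP => // _; case: eqP. Qed.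

(* The faces F of the other variables whose union with r of the variables x_a,
   x_b is a face in a multidegree nu x_a^(d - s) x_b^s; here t is the
   x_b-exponent of the corresponding monomial, of (a, b)-degree d - r. *)
Definition part U nu i d r t : {set {set 'I_n}} :=
  [set F : {set 'I_n} | [&& a \notin F, b \notin F, #|F| + r == i,
     [forall q in F, 0 < nu q], t + r <= d &
     U (setab (nu - mnm_ind F)%MM (d - r - t) t)]].

Variables (U : pred 'X_{1..n}) (nu : 'X_{1..n}) (i d : nat).
Local Notation mu t := (setab nu (d - t) t).
Local Notation K t := (faces U i (mu t)).
Local Notation X := (part U nu i d).

Lemma subset_setab F s t : a \notin F -> b \notin F ->
  (mnm_ind F <= setab nu s t)%MM = [forall q in F, 0 < nu q].
Proof.
move=> aF bF; apply/mnm_lepP/forall_inP => h q.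
  move=> qF; move: (h q); rewrite !mnmE qF.
  by case: eqP => [E|_]; [rewrite -E qF in aF | case: eqP => [E|_] //;
    rewrite -E qF in bF].
rewrite !mnmE; case qF: (q \in F) => //.
case: eqP => [E|_]; first by rewrite -E qF in aF.
by case: eqP => [E|_]; [rewrite -E qF in bF | apply: h].
Qed.

Lemma part0E t : t <= d -> slice0 a b (K t) = X 0 t.
Proof.
move=> td; apply/setP => F; rewrite !inE negb_or -!andbA.
case aF: (a \in F) => //=; case bF: (b \in F) => //=.
rewrite addn0 addn0 td subset_setab ?aF ?bF // subn0 /=.
congr [&& _, _ & U _]; apply/mnmP => q; rewrite !mnmE.
by case: eqP => [->|_]; [rewrite aF subn0 | case: eqP => [->|_]; rewrite ?bF ?subn0].
Qed.

Lemma subset_setabU p F s t : p \notin F ->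
  (mnm_ind (p |: F) <= setab nu s t)%MM =
  (0 < setab nu s t p) && (mnm_ind F <= setab nu s t)%MM.
Proof.
move=> pF; apply/mnm_lepP/andP => [h|[h0 /mnm_lepP h] q].
  split; first by have := h p; rewrite mnmE setU11.
  apply/mnm_lepP => q; apply: leq_trans (h q).
  by rewrite !mnmE !inE; case: (q \in F); rewrite ?orbT.
by rewrite mnmE !inE; case: eqP => [->|_] //=; have := h q; rewrite mnmE.
Qed.

Lemma part1aE t : t <= d -> slice1 a b a (K t) = X 1 t.
Proof.
move=> td; apply/setP => F; rewrite !inE negb_or -!andbA.
case aF: (a \in F) => //=; case bF: (b \in F) => //=.
rewrite cardsU1 aF /= add1n subset_setabU ?aF // setab_a subset_setab ?aF ?bF //.
rewrite !addn1 subn_gt0 -!andbA; case: (#|F|.+1 == i) => //=.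
rewrite andbCA; case: [forall q in F, _] => //=; congr (_ && U _).
apply/mnmP => q; rewrite !mnmE !inE.
case: (q =P a) => [->|_] /=; first by rewrite subnAC.
by case: eqP => [->|_]; rewrite ?bF ?subn0.
Qed.

Lemma part1bE t : t <= d -> slice1 a b b (K t) = shift (X 1) t.
Proof.
move=> td; apply/setP => F; rewrite !inE negb_or -!andbA.
case: t td => [|t] td /=.
  rewrite inE; case aF: (a \in F) => //=; case bF: (b \in F) => //=.
  by rewrite subset_setabU ?bF // setab_b /= andbF.
rewrite inE; case aF: (a \in F) => //=; case bF: (b \in F) => //=.
rewrite cardsU1 bF /= add1n subset_setabU ?bF // setab_b subset_setab ?aF ?bF //.
rewrite !addn1 td; case: (#|F|.+1 == i) => //=.
case: [forall q in F, _] => //=; congr (U _).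
apply/mnmP => q; rewrite !mnmE !inE.
case: (q =P a) => [->|_] /=; first by rewrite (negPf ab) aF subn0; lia.
by case: eqP => [_|_] //=; rewrite subn1.
Qed.

Lemma part2E t : t <= d -> slice2 a b (K t) = shift (X 2) t.
Proof.
move=> td; apply/setP => F; rewrite !inE negb_or -!andbA.
case: t td => [|t] td /=.
  rewrite inE; case aF: (a \in F) => //=; case bF: (b \in F) => //=.
  rewrite subset_setabU ?inE ?negb_or ?ab ?aF //.
  by rewrite subset_setabU ?bF // setab_b /= !andbF.
rewrite inE; case aF: (a \in F) => //=; case bF: (b \in F) => //=.
rewrite cardsU1 !inE (negPf ab) aF cardsU1 bF /= !add1n addn2.
rewrite subset_setabU ?inE ?negb_or ?ab ?aF //.
rewrite subset_setabU ?bF // setab_a setab_b subset_setab ?aF ?bF //=.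
rewrite addn2 subn_gt0; case: (#|F|.+2 == i) => //=.
rewrite andbCA -!andbA; case: [forall q in F, _] => //=; congr (_ && U _).
apply/mnmP => q; rewrite !mnmE !inE.
case: (q =P a) => [->|_] /=; first by lia.
by case: eqP => [_|_] //=; rewrite subn1.
Qed.

Lemma card_faces_fibre :
  \sum_(t < d.+1) #|K t| =
  \sum_(t < d.+1) #|X 0 t| + \sum_(t < d.+1) #|X 1 t|
  + (\sum_(t < d.+1) #|shift (X 1) t| + \sum_(t < d.+1) #|shift (X 2) t|).
Proof.
rewrite -!big_split; apply: eq_bigr => t _ /=.
have td : t <= d by rewrite -ltnS.
rewrite -part0E // -part1aE // -part1bE // -part2E //.
exact: card_slices.
Qed.

End Fibre.

Lemma sum_ltn_ord m c : \sum_(t < m) (t < c) = minn m c.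
Proof.
elim: m => [|m IH]; first by rewrite big_ord0 min0n.
by rewrite big_ord_recr /= IH; case: ltnP; lia.
Qed.

Lemma sum_card_level (T : finType) (x : nat -> {set T}) m :
  \sum_(t < m) #|level (count_in m x) t| = \sum_(t < m) #|x t|.
Proof.
have E (y : nat -> {set T}) : \sum_(t < m) #|y t| = \sum_e count_in m y e.
  rewrite /count_in exchange_big; apply: eq_bigr => t _.
  by rewrite -sum1_card big_mkcond; apply: eq_bigr => e _; case: (e \in _).
rewrite !E; apply: eq_bigr => e _; rewrite {1}/count_in.
under eq_bigr do rewrite inE.
by rewrite sum_ltn_ord; apply/minn_idPr/count_in_le.
Qed.

Section Compression.
Variables (n : nat) (a b : 'I_n) (h : option nat).
Hypothesis ab : a != b.
Implicit Types (U : pred 'X_{1..n}) (m mu nu : 'X_{1..n}) (C F : {set 'I_n}).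

Definition below t := if h is Some h' then t < h' else true.

Definition fibre_count U m :=
  \sum_(t < (m a + m b).+1) (below t && U (setab a b m (m a + m b - t) t)).

Definition compression U : pred 'X_{1..n} :=
  fun m => ~~ below (m b) || (m b < fibre_count U m).

Hypothesis h0 : h != Some 0.

Section Fibre.
Variables (U : pred 'X_{1..n}) (nu : 'X_{1..n}) (i d : nat).
Hypothesis Ub : forall m, ~~ below (m b) -> U m.
Hypothesis Ua : forall m, ~~ below (m a) -> U m.
Local Notation mu t := (setab a b nu (d - t) t).
Local Notation X := (part a b U nu i d).
Local Notation Y := (part a b (compression U) nu i d).

(** The range is taken from d also for the parts of degree d - 1 and d - 2. Their extra positions
    are empty, so all three families are compressed over one common range. *)
Definition window := if h is Some h' then minn h' d.+1 else d.+1.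

Lemma window_gt0 : 0 < window.
Proof. by move: h0; rewrite /window; case: h => [[|h']|] // _; rewrite leq_min. Qed.

Lemma window_le : window <= d.+1.
Proof. by rewrite /window; case: h => // h'; apply: geq_minr. Qed.

Lemma ltn_window t : (t < window) = below t && (t <= d).
Proof. by rewrite /window /below; case: h => //= h'; rewrite leq_min ltnS. Qed.

Lemma part_high r t : window <= t -> X r t = Y r t.
Proof.
move=> wt; apply/setP => F; rewrite !inE; do 4![congr (_ && _)].
case: leqP => //= td.
have nb : ~~ below t.
  by move: wt; rewrite leqNgt ltn_window negb_and -ltnNge; case/orP => //; lia.
by rewrite /compression !setab_b ?Ub ?setab_b ?nb.
Qed.

Lemma part_low r t : t < window -> Y r t = compress window.-1 (X r) t.
Proof.
move=> tw; apply/setP => F; rewrite !inE prednK ?window_gt0 // /count_in.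
under eq_bigr do rewrite inE.
case: (a \notin F); last by rewrite big1.
case: (b \notin F); last by rewrite big1.
case: (#|F| + r == i); last by rewrite big1.
case: [forall q in F, 0 < nu q]; last by rewrite big1.
rewrite /=; have [rd|dr] := leqP r d; last first.
  by rewrite big1 => [|s _]; rewrite leqNgt ltn_addl.
have bt : below t by move: tw; rewrite ltn_window => /andP[].
rewrite /compression setab_b // bt /= /fibre_count setab_a setab_b //.
(* Only the positions 0, ..., d - r can be occupied, so no count exceeds a position t beyond
   them. *)
have [td|dt] := leqP (t + r) d; last first.
  symmetry; apply/negbTE; rewrite -leqNgt.
  apply: (@leq_trans (\sum_(s < window) (s < (d - r).+1))).
    by apply: leq_sum => s _; case: (U _); rewrite ?andbF // andbT; lia.
  by rewrite sum_ltn_ord; lia.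
have -> : d - r - t + t = d - r by lia.
congr (_ < _); rewrite (big_ord_widen d.+1
  (fun s => nat_of_bool (below s && U (setab a b (setab a b (nu - mnm_ind F)%MM
    (d - r - t) t) (d - r - s) s)))); last by lia.
rewrite (big_ord_widen d.+1 (fun s =>
  nat_of_bool ((s + r <= d) && U (setab a b (nu - mnm_ind F)%MM
    (d - r - s) s))) window_le).
rewrite big_mkcond [RHS]big_mkcond; apply: eq_bigr => s _.
rewrite setab_setab ltn_window -[s <= d]ltnS ltn_ord andbT ltnS.
by case: (below s); rewrite ?if_same //= leq_subRL // addnC; case: leqP.
Qed.

Lemma sum_card_part r :
  \sum_(t < d.+1) #|Y r t| = \sum_(t < d.+1) #|X r t|.
Proof.
rewrite -(big_mkord xpredT (fun t => #|Y r t|)) -(big_mkord xpredT (fun t => #|X r t|)).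
rewrite [LHS](big_cat_nat (n := window)) ?window_le //=.
rewrite [RHS](big_cat_nat (n := window)) ?window_le //=; congr (_ + _).
  rewrite !big_mkord -(sum_card_level (X r)); apply: eq_bigr => t _.
  by rewrite part_low // /compress prednK ?window_gt0.
by rewrite big_nat_cond [RHS]big_nat_cond; apply: eq_bigr => t /andP[/andP[wt _] _];
  rewrite part_high.
Qed.

Lemma part_empty U' r t : d < t + r -> part a b U' nu i d r t = set0.
Proof.
by move=> dt; apply/setP => F; rewrite !inE leqNgt dt /= !andbF.
Qed.

Lemma card_faces_compression :
  \sum_(t < d.+1) #|faces (compression U) i (mu t)| =
  \sum_(t < d.+1) #|faces U i (mu t)|.
Proof.
rewrite !(card_faces_fibre ab) !sum_card_part; congr (_ + _).
(* Shifting loses position d, which is empty when r is positive. *)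
have E r : 0 < r -> \sum_(t < d) #|Y r t| = \sum_(t < d) #|X r t|.
  move=> r0; have := sum_card_part r.
  have e U' : part a b U' nu i d r d = set0 by rewrite part_empty // -addn1 leq_add2l.
  by rewrite [LHS]big_ord_recr [RHS]big_ord_recr /= !e cards0 !addn0.
by rewrite !big_ord_recl /= !cards0; congr (_ + (_ + _)); rewrite ?E.
Qed.

Let full r := [set F : {set 'I_n} | [&& a \notin F, b \notin F, #|F| + r == i &
     [forall q in F, 0 < nu q]]].

Lemma part_sub_full U' r t : part a b U' nu i d r t \subset full r.
Proof. by apply/subsetP => F; rewrite !inE => /and5P[-> -> -> ->]. Qed.

Lemma part_high_full r t : window <= t -> t + r <= d -> X r t = full r.
Proof.
move=> wt tr; apply/setP => F; rewrite !inE; do 3![congr (_ && _)].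
rewrite tr Ub ?andbT // setab_b //.
by move: wt; rewrite leqNgt ltn_window negb_and; case/orP => //; lia.
Qed.

(** The bound forces d - r >= h, and d - r is the x_a-exponent at position 0, so [Ua] applies. This
    is where e_a <= e_b enters the comparison of cycles. *)
Lemma part_start_full r : window <= d - r -> r <= d -> X r 0 = full r.
Proof.
move=> wr rd; apply/setP => F; rewrite !inE; do 3![congr (_ && _)].
rewrite rd Ua ?andbT // setab_a subn0.
by move: wr; rewrite leqNgt ltn_window negb_and; case/orP => //; lia.
Qed.

Lemma rank_cycles_compression (k : fieldType) :
  \sum_(t < d.+1) rank_cycles k (faces U i (mu t)) <=
  \sum_(t < d.+1) rank_cycles k (faces (compression U) i (mu t)).
Proof.
have td (t : 'I_d.+1) : t <= d by rewrite -ltnS.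
apply: (@leq_trans (fibre_sum (bdy k (others a b)) d (X 2) (X 1) (X 0))).
  apply: leq_sum => t _; rewrite -part0E -?part1aE -?part1bE -?part2E //.
  exact: rank_cycles_le.
apply: (@leq_trans (fibre_sum (bdy k (others a b)) d (Y 2) (Y 1) (Y 0))); last first.
  apply: leq_sum => t _; rewrite -part0E -?part1aE -?part1bE -?part2E //.
  (* Neighbouring sets are nested: inside the window compressed sets decrease, beyond it the set is
     full, and at position d it is empty. *)
  apply: rank_cycles_ge => //; rewrite part1aE ?part1bE //.
  case: (nat_of_ord t) => [|s] /=; first by rewrite sub0set orbT.
  have [lt|le] := ltnP s.+1 window.
    by rewrite !part_low ?(ltnW lt) // compressS.
  have [dt|td'] := leqP d s.+1; first by rewrite part_empty ?sub0set // addn1.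
  rewrite -part_high // (part_high_full le) ?part_sub_full ?orbT //.
  by rewrite addn1.
have wd := window_le; have w0 := window_gt0.
apply: (@fibre_sum_compress _ _ _ (@bdy_bdy k n (others a b)) d window.-1
  _ _ _ _ _ _ (full 1) (full 0)) => //.
- by rewrite -ltnS prednK.
- by move=> t dt; rewrite part_empty // addn1 ltnS.
- by move=> t dt; rewrite part_empty // addn2 ltnS.
- by move=> t; apply: part_sub_full.
- by move=> t; apply: part_sub_full.
- rewrite prednK // => wN.
  by rewrite part_start_full ?subn0 // part_high_full ?addn0.
- rewrite prednK // => wN; rewrite part_start_full ?part_high_full //; lia.
- by move=> t; rewrite -ltnS prednK // => tw; rewrite !part_low.
- by move=> t wt; rewrite !part_high // -(prednK w0).
Qed.

End Fibre.
End Compression.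

(** * Monomials of a given degree, grouped into fibres *)

Section Monomials.
Variable n : nat.
Implicit Types (U : pred 'X_{1..n}) (m mu nu : 'X_{1..n}) (a b : 'I_n).

Definition monos j : seq 'X_{1..n} :=
  [seq bmnm x | x <- enum {: 'X_{1..n < j.+1}} & mdeg (bmnm x) == j].

Lemma mem_monos j m : (m \in monos j) = (mdeg m == j).
Proof.
apply/mapP/idP => [[m' + ->]|mj]; first by rewrite mem_filter => /andP[].
have lt : mdeg m < j.+1 by rewrite (eqP mj).
exists (BMultinom lt) => //; rewrite mem_filter mem_enum andbT. exact: mj.
Qed.

Lemma monos_uniq j : uniq (monos j).
Proof.
by rewrite (map_inj_uniq (@val_inj _ _ 'X_{1..n < j.+1})) filter_uniq ?enum_uniq.
Qed.

Lemma mdeg_setab a b m s t : a != b ->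
  mdeg (setab a b m s t) + (m a + m b) = mdeg m + (s + t).
Proof.
move=> ab; rewrite !mdegE.
rewrite (bigD1 a) //= (bigD1 b) /=; last by rewrite eq_sym.
rewrite [X in _ = X + _](bigD1 a) //= [X in _ = _ + X + _](bigD1 b) /=;
  last by rewrite eq_sym.
rewrite setab_a setab_b //.
have -> : \sum_(q < n | (q != a) && (q != b)) setab a b m s t q =
    \sum_(q < n | (q != a) && (q != b)) m q.
  by apply: eq_bigr => q /andP[/negPf qa /negPf qb]; rewrite mnmE qa qb.
ring.
Qed.

(** Each fibre is represented by its monomial without x_b, whose x_a-exponent is then the (a,
    b)-degree. *)
Lemma perm_monos_fibre a b j : a != b ->
  perm_eq (monos j)
    [seq setab a b nu (nu a - t) t
       | nu : 'X_{1..n} <- [seq nu : 'X_{1..n} <- monos j | nu b == 0],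
         t : nat <- iota 0 (nu a).+1].
Proof.
move=> ab; apply: uniq_perm => [||m]; first exact: monos_uniq.
  apply: allpairs_uniq_dep => [|nu _|];
    [exact/filter_uniq/monos_uniq|exact: iota_uniq|].
  move=> p p' /allpairsPdep[x [y [xs ys ->]]] /allpairsPdep[x' [y' [xs' ys' ->]]] /= E.
  move: xs ys xs' ys'; rewrite !mem_filter !mem_iota !add0n !ltnS.
  move=> /andP[/eqP xb _] /= ya /andP[/eqP xb' _] /= ya'.
  have Eb : y = y' by rewrite -(setab_b ab x (x a - y) y) E setab_b.
  have Ea : x a = x' a.
    by move/(congr1 (fun m : 'X_{1..n} => m a)): E; rewrite !setab_a Eb in ya *; lia.
  have Ex : x = x'.
    apply/mnmP => q; have [->|qa] := eqVneq q a; first by [].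
    have [->|qb] := eqVneq q b; first by rewrite xb xb'.
    move/(congr1 (fun m : 'X_{1..n} => m q)): E.
    by rewrite !mnmE (negPf qa) (negPf qb).
  by rewrite Ex Eb.
apply/idP/allpairsPdep => [mj|[nu [t [+ + ->]]]].
  exists (setab a b m (m a + m b) 0), (m b); split.
  - rewrite mem_filter setab_b // eqxx /= mem_monos.
    have := mdeg_setab m (m a + m b) 0 ab; rewrite mem_monos in mj.
    by rewrite (eqP mj) addn0 => /addIn ->.
  - by rewrite mem_iota setab_a add0n ltnS leq_addl.
  - by rewrite setab_setab setab_a addnK setab_id.
rewrite mem_filter !mem_monos mem_iota add0n ltnS => /andP[/eqP nb /eqP nj] /= ta.
have := mdeg_setab nu (nu a - t) t ab; rewrite nj nb; lia.
Qed.

Lemma sum_monos_fibre a b j (F : 'X_{1..n} -> nat) : a != b ->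
  \sum_(m <- monos j) F m =
  \sum_(nu <- monos j | nu b == 0)
    \sum_(t < (nu a).+1) F (setab a b nu (nu a - t) t).
Proof.
move=> ab; rewrite (perm_big _ (perm_monos_fibre j ab)) big_allpairs_dep big_filter.
apply: eq_bigr => nu _; rewrite -[iota 0 _]/(index_iota 0 (nu a).+1).
exact: (big_mkord xpredT (fun t => F (setab a b nu (nu a - t) t))).
Qed.

End Monomials.

(** The boolean term records strictness, which later forces the iteration to stop. In the induction
    an occupied last position w is compared with c <= w, the element by which the initial segment
    grows; equality means that everything is occupied. *)
Lemma sum_initial_segment w (u : nat -> bool) (c := \sum_(t < w) u t) :
  \sum_(t < w) t * (t < c) + ~~ [forall t : 'I_w, u t == (t < c)] <=
  \sum_(t < w) t * u t.
Proof.
rewrite {}/c; elim: w => [|w IH].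
  by rewrite !big_ord0; case: forallP => // -[] [].
rewrite (big_ord_recr w (fun t => nat_of_bool (u t))) /=.
set c := \sum_(t < w) u t in IH *.
have cle : c <= w := sum_bool_leq _.
rewrite [leqRHS]big_ord_recr /=; case uw: (u w) => /=; last first.
  rewrite addn0 muln0 addn0 big_ord_recr /= ltnNge cle muln0 addn0.
  apply: leq_trans IH; rewrite leq_add2l; case: forallP => // nh.
  case: forallP => // h; case: nh => t; have [tw|wt] := ltnP t w.
    exact: h (Ordinal tw).
  have -> : nat_of_ord t = w by apply/eqP; rewrite eqn_leq wt -ltnS ltn_ord.
  by rewrite uw ltnNge cle.
have Ec : \sum_(t < w.+1) t * (t < c + 1) = \sum_(t < w) t * (t < c) + c.
  have E v : c <= v -> \sum_(t < v.+1) t * (t < c + 1) =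
      \sum_(t < v) t * (t < c) + c.
    elim: v => [|v IHv]; first by rewrite leqn0 big_ord_recr !big_ord0 => /eqP ->.
    rewrite leq_eqVlt => /orP[/eqP Ev|cv].
      rewrite big_ord_recr /= -Ev addn1 ltnSn muln1; congr (_ + _).
      by apply: eq_bigr => t _; rewrite ltn_ord ltnS ltnW ?ltn_ord.
    rewrite big_ord_recr IHv // [in RHS]big_ord_recr /= addn1.
    by rewrite ltnS ltnNge (cv : c <= v) !muln0 !addn0.
  exact: E.
rewrite Ec muln1; have [Ew|cltw] := eqVneq c w.
  have -> : [forall t : 'I_w.+1, u t == (t < c + 1)]; last first.
    by rewrite /= addn0 [X in _ + X <= _]Ew leq_add2r (leq_trans _ IH) ?leq_addr.
  apply/forallP => t; rewrite addn1 Ew ltn_ord eqb_id.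
  have [tw|wt] := ltnP t w; last first.
    by have -> : nat_of_ord t = w by apply/eqP; rewrite eqn_leq wt -ltnS ltn_ord.
  have : \sum_(t < w) ~~ u t = 0.
    apply/eqP; rewrite -(eqn_add2l c) addn0 -big_split /= Ew.
    rewrite (eq_bigr (fun=> 1)) => [|s _]; last by case: (u s).
    by rewrite sum1_card card_ord.
  by move=> /eqP; rewrite sum_nat_eq0 => /forallP /(_ (Ordinal tw)); case: (u t).
have {}cltw : c < w by rewrite ltn_neqAle cltw.
have {}IH := leq_trans (leq_addr _ _) IH.
rewrite -addnA leq_add //; case: (~~ _); rewrite ?addn1 ?addn0 //.
Qed.

(** * Effect of one compression on ideals, cycles and weights *)

Section Improvement.
Variables (k : fieldType) (n : nat).
Implicit Types (U V W : pred 'X_{1..n}) (m mu nu : 'X_{1..n}) (a b q : 'I_n).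

Definition rank_sum U i j := \sum_(mu <- monos n j) rank_cycles k (faces U i mu).

Definition face_sum U i j := \sum_(mu <- monos n j) #|faces U i mu|.

(** Replacing a factor x_b by x_a lowers this by b - a, so its total over a degree serves as
    termination measure. *)
Definition index_weight m := \sum_(q < n) q * m q.

Definition weight U j := \sum_(m <- monos n j | U m) index_weight m.

Definition upclosed U := forall m q, U m -> U (m + U_(q))%MM.

Variable e : 'I_n -> option nat.

Definition contains_powers U := forall q m, ~~ below (e q) (m q) -> U m.

Section Pair.
Variables (a b : 'I_n).
Hypothesis ltab : a < b.
Hypothesis eb0 : e b != Some 0.
Hypothesis eab : forall t, below (e a) t -> below (e b) t.

Local Notation h := (e b).
Local Notation comp := (compression a b h).

Let ab : a != b.
Proof. by rewrite -(inj_eq val_inj) ltn_eqF. Qed.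

Lemma below_le x s t : s <= t -> below x t -> below x s.
Proof. by case: x => //= x; apply: leq_ltn_trans. Qed.

(** If m is a multiple of the q-th power and [m b] is below e_b, then q is not b, and trading x_b
    for x_a preserves divisibility. So the fibre has at least m b + 1 monomials of P in the sorted
    range. *)
Lemma compression_contains U : contains_powers U -> contains_powers (comp U).
Proof.
move=> PU q m bq; rewrite /compression.
have [bm|//] := boolP (below h (m b)); rewrite /= /fibre_count.
set D := m a + m b.
have all t : t <= m b -> U (setab a b m (D - t) t).
  move=> tb; apply: (PU q); rewrite mnmE.
  have [E|qa] := eqVneq q a.
    by apply: contra bq; apply: below_le; rewrite E /D; lia.
  have [E|qb //] := eqVneq q b; by rewrite E bm in bq.
apply: (@leq_trans (\sum_(t < D.+1) (t < (m b).+1))).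
  by rewrite sum_ltn_ord leq_min ltnSn andbT /D; lia.
apply: leq_sum => t _; case: ltnP => // tb.
by rewrite all // (@below_le _ _ (m b)).
Qed.

Lemma setab_add q m s t : q != a -> q != b ->
  setab a b (m + U_(q))%MM s t = (setab a b m s t + U_(q))%MM.
Proof.
move=> qa qb; apply/mnmP => r; rewrite !mnmE.
case: (eqVneq r a) => [->|ra]; first by rewrite (negPf qa) addn0.
by case: (eqVneq r b) => [->|rb]; rewrite ?(negPf qb) ?addn0.
Qed.

Lemma setab_add_a m s t : setab a b m s.+1 t = (setab a b m s t + U_(a))%MM.
Proof.
apply/mnmP => r; rewrite !mnmE [a == r]eq_sym.
by case: (eqVneq r a) => [_|_]; rewrite ?addn1 ?addn0.
Qed.

Lemma setab_add_b m s t : setab a b m s t.+1 = (setab a b m s t + U_(b))%MM.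
Proof.
apply/mnmP => r; rewrite !mnmE [b == r]eq_sym.
case: (eqVneq r a) => [->|_]; first by rewrite (negPf ab) addn0.
by case: (eqVneq r b) => [_|_]; rewrite ?addn1 ?addn0.
Qed.

Lemma setab_addab q m s t : q \in [:: a; b] ->
  setab a b (m + U_(q))%MM s t = setab a b m s t.
Proof.
move=> qab; apply/mnmP => r; rewrite !mnmE.
case: (eqVneq r a) => // ra; case: (eqVneq r b) => // rb.
by move: qab; rewrite !inE => /orP[] /eqP ->;
  rewrite eq_sym ?(negPf ra) ?(negPf rb) addn0.
Qed.

(* For multiplication by x_b, count the positions in the next degree with
   [cyclic_counts]: if e_b is at most the next degree, then the position of
   x_b-exponent 0 belongs to P as e_a <= e_b, which closes the cycle. *)
Lemma compression_upclosed U : contains_powers U -> upclosed U ->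
  upclosed (comp U).
Proof.
move=> PU cU m q; rewrite /compression => /orP[nb|lt].
  rewrite (contraNN _ nb) //; apply: below_le; rewrite mnmDE; exact: leq_addr.
case bm': (below h ((m + U_(q))%MM b)) => //=.
pose D := m a + m b.
have [Ea|qa] := eqVneq q a.
  apply: (@leq_trans (fibre_count a b h U m)).
    by rewrite mnmDE mnm1E Ea (negPf ab) addn0.
  rewrite /fibre_count !mnmDE !mnm1E Ea eqxx (negPf ab) addn0 addn1 addSn.
  rewrite [leqRHS]big_ord_recr /=; apply: leq_trans (leq_addr _ _).
  apply: leq_sum => t _; have tD : t <= m a + m b by rewrite -ltnS.
  case: (below h t) => //=; rewrite setab_addab ?inE ?eqxx // subSn //.
  by rewrite setab_add_a; case u: (U _) => //; rewrite cU.
have [Eb|qb] := eqVneq q b; last first.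
  apply: (@leq_trans (fibre_count a b h U m)).
    by rewrite mnmDE mnm1E (negPf qb) addn0.
  rewrite /fibre_count !mnmDE !mnm1E (negPf qa) (negPf qb) !addn0.
  apply: leq_sum => t _; case: (below h t) => //=; rewrite setab_add //.
  by case u: (U _) => //; rewrite cU.
rewrite {}Eb {q qa} in bm' *.
rewrite mnmDE mnm1E eqxx addn1 in bm' *.
rewrite /fibre_count !mnmDE !mnm1E eqxx eq_sym (negPf ab) addn0 addn1 addnS.
rewrite /fibre_count -/D in lt; rewrite -/D.
under eq_bigr do rewrite setab_addab ?inE ?eqxx ?orbT //.
pose w := if h is Some h' then minn h' D.+2 else D.+2.
have w0 : 0 < w by move: eb0; rewrite /w; case: h => [[|h']|] // _; rewrite leq_min.
have wE t : (t < w) = below h t && (t < D.+2).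
  by rewrite /w /below; case: h => //= h'; rewrite leq_min.
have wD : w <= D.+2 by rewrite leqNgt wE ltnn andbF.
pose u t := (t <= D) && U (setab a b m (D - t) t).
pose u' t := U (setab a b m (D.+1 - t) t).
have step t : u t -> u' t /\ u' t.+1.
  rewrite /u /u' => /andP[tD ut]; split; last first.
    by rewrite subSS setab_add_b; apply: cU.
  by rewrite subSn // setab_add_a; apply: cU.
have Eu : \sum_(t < D.+1) (below h t && U (setab a b m (D - t) t)) =
    \sum_(t < w) u t.
  rewrite (big_ord_widen D.+2 (fun t => nat_of_bool
    (below h t && U (setab a b m (D - t) t)))) //.
  rewrite (big_ord_widen D.+2 (fun t => nat_of_bool (u t))) //.
  rewrite big_mkcond [RHS]big_mkcond; apply: eq_bigr => t _.
  by rewrite wE ltn_ord andbT ltnS /u; case: (below h t); case: leqP.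
have Eu' : \sum_(t < D.+2) (below h t && U (setab a b m (D.+1 - t) t)) =
    \sum_(t < w) u' t.
  rewrite (big_ord_widen D.+2 (fun t => nat_of_bool (u' t))) // [RHS]big_mkcond.
  apply: eq_bigr => t _; by rewrite wE ltn_ord andbT /u'; case: (below h t).
rewrite Eu in lt; rewrite Eu'.
have u0 : u 0 || u w.-1 -> u' 0.
  case/orP => [/step[]//|uw]; apply: (PU a).
  rewrite setab_a subn0; apply: contraTN uw => bD; rewrite /u negb_and -ltnNge.
  have -> : D < w.-1; last by [].
  suff -> : w = D.+2 by [].
  by apply/eqP; rewrite eqn_leq wD wE ltnSn andbT eab.
have [_] := cyclic_counts w.-1 u; rewrite prednK // => cc.
set c := \sum_(t < w) u t in lt cc.
set q := _ + _ in cc.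
have qu' : q <= \sum_(t < w) u' t.
  have -> : \sum_(t < w) u' t = u' 0 + \sum_(t < w.-1) u' t.+1.
    by case: w w0 {wE wD Eu Eu' u0 c lt cc q} => // w' _; rewrite big_ord_recl.
  rewrite /q leq_add //.
    by case: (_ || _) u0 => // ->.
  apply: leq_sum => t _.
  case E1: (u t.+1); first by have [-> _] := step _ E1.
  by case E2: (u t) => //; have [_ ->] := step _ E2.
apply: leq_trans qu'; case: cc => [cq|[[c0 _]|[cw ->]]].
- by apply: leq_trans cq; rewrite ltnS.
- by rewrite c0 in lt.
- by rewrite wE bm' /D; lia.
Qed.

Section Sums.
Variables (U : pred 'X_{1..n}) (j : nat).
Hypothesis PU : contains_powers U.

Let Ub m : ~~ below h (m b) -> U m.
Proof. exact: PU. Qed.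

Let Ua m : ~~ below h (m a) -> U m.
Proof. by move=> na; apply: (PU (q := a)); apply: contra na; apply: eab. Qed.

Lemma rank_sum_compression i : rank_sum U i j <= rank_sum (comp U) i j.
Proof.
rewrite /rank_sum !(sum_monos_fibre _ _ ab); apply: leq_sum => nu _.
exact: rank_cycles_compression.
Qed.

Lemma face_sum_compression i : face_sum (comp U) i j = face_sum U i j.
Proof.
rewrite /face_sum !(sum_monos_fibre _ _ ab); apply: eq_bigr => nu _.
exact: card_faces_compression.
Qed.

(** On a fibre the weight is affine in the x_b-exponent with slope b - a > 0, so
    [sum_initial_segment] applies fibre by fibre; one changed fibre suffices for a strict drop. *)
Lemma weight_compression :
  weight (comp U) j + ~~ all (fun m => comp U m == U m) (monos n j) <= weight U j.
Proof.
rewrite /weight big_mkcond [in leqRHS]big_mkcond !(sum_monos_fibre _ _ ab).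
pose ch nu := [exists t : 'I_(nu a).+1, comp U (setab a b nu (nu a - t) t)
    != U (setab a b nu (nu a - t) t)].
apply: (@leq_trans (\sum_(nu <- monos n j | nu b == 0)
  (\sum_(t < (nu a).+1) (if comp U (setab a b nu (nu a - t) t) then
     index_weight (setab a b nu (nu a - t) t) else 0) + ch nu))).
  rewrite big_split leq_add2l /=; case: allPn => // -[m mj neq].
  move: mj; rewrite (perm_mem (perm_monos_fibre j ab)).
  case/allpairsPdep => nu [t [nuj + Em]]; rewrite mem_iota add0n /= => tnu.
  rewrite -big_filter (big_rem nu) //=; have -> //: ch nu.
  by apply/existsP; exists (Ordinal tnu); rewrite /= -Em.
apply: leq_sum => nu /eqP nub; set D := nu a.
pose u t := U (setab a b nu (D - t) t).
pose v t := comp U (setab a b nu (D - t) t).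
pose w := window h D.
have wD : w <= D.+1 by apply: window_le.
have uv t : w <= t -> t < D.+1 -> v t = u t.
  move=> wt tD; have nb : ~~ below h t.
    by move: wt; rewrite leqNgt ltn_window negb_and -ltnNge; case/orP => //; lia.
  by rewrite /v /u /compression setab_b // nb Ub ?setab_b.
pose c := \sum_(t < w) u t.
have vc t : t < w -> v t = (t < c).
  rewrite ltn_window => /andP[bt tD].
  rewrite /v /compression setab_b // bt /= /fibre_count setab_a setab_b // subnK //.
  congr (_ < _); rewrite /c (big_ord_widen D.+1 (fun t => nat_of_bool (u t)) wD).
  rewrite [RHS]big_mkcond; apply: eq_bigr => s _; rewrite setab_setab ltn_window.
  by rewrite -[s <= D]ltnS ltn_ord andbT; case: (below h s).
have Wt t : t <= D -> index_weight (setab a b nu (D - t) t)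
    = index_weight nu + (b - a) * t.
  move=> tD; apply/eqP.
  rewrite -(eqn_add2r (a * D)); apply/eqP; rewrite /index_weight.
  rewrite (bigD1 a) //= (bigD1 b) /=; last by rewrite eq_sym.
  rewrite [in RHS](bigD1 a) //= [in RHS](bigD1 b) /=; last by rewrite eq_sym.
  rewrite setab_a setab_b // nub -/D.
  have -> : \sum_(q < n | (q != a) && (q != b)) q * setab a b nu (D - t) t q =
      \sum_(q < n | (q != a) && (q != b)) q * nu q.
    by apply: eq_bigr => q /andP[/negPf qa /negPf qb]; rewrite mnmE qa qb.
  rewrite muln0 add0n mulnBr mulnBl.
  have := leq_mul (leqnn a) tD; have := leq_mul (ltnW ltab) (leqnn t).
  move: (\sum_(_ < n | _) _) (a * D) (a * t) (b * t) => x y z y'; lia.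
have split (x : nat -> bool) : \sum_(t < D.+1)
      (if x t then index_weight (setab a b nu (D - t) t) else 0) =
    index_weight nu * \sum_(t < w) x t + (b - a) * \sum_(t < w) t * x t
    + \sum_(w <= t < D.+1)
       (if x t then index_weight (setab a b nu (D - t) t) else 0).
  rewrite -(big_mkord xpredT (fun t =>
    if x t then index_weight (setab a b nu (D - t) t) else 0)).
  rewrite (big_cat_nat (n := w)) //= big_mkord; congr (_ + _).
  rewrite !big_distrr -big_split; apply: eq_bigr => t _ /=.
  case: (x t); rewrite ?muln0 // !muln1 Wt //.
  by rewrite -ltnS (leq_trans (ltn_ord t)).
rewrite (split v) (split u).
have -> : \sum_(w <= t < D.+1) (if v t then index_weight (setab a b nu (D - t) t)
  else 0)
  = \sum_(w <= t < D.+1) (if u t then index_weight (setab a b nu (D - t) t) else 0).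
  rewrite big_nat_cond [RHS]big_nat_cond.
  by apply: eq_bigr => t /andP[/andP[wt tD] _]; rewrite uv.
have -> : \sum_(t < w) v t = c.
  rewrite (eq_bigr (fun t : 'I_w => nat_of_bool (t < c))) => [|t _]; last by rewrite vc.
  by rewrite sum_ltn_ord; apply/minn_idPr/sum_bool_leq.
have -> : \sum_(t < w) t * v t = \sum_(t < w) t * (t < c).
  by apply: eq_bigr => t _; rewrite vc.
rewrite addnAC leq_add2r -addnA leq_add2l.
have chle : ch nu <= ~~ [forall t : 'I_w, u t == (t < c)].
  case: forallP => h; last by case: (ch nu).
  rewrite /ch; case: existsP => // -[t]; rewrite -/(v t) -/(u t).
  have [tw|wt] := ltnP t w; last by rewrite uv ?eqxx.
  by rewrite vc // (eqP (h (Ordinal tw))) eqxx.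
have ba : 0 < b - a by rewrite subn_gt0.
have le : \sum_(t < w) t * (t < c) + ch nu <= \sum_(t < w) t * u t.
  by apply: leq_trans (sum_initial_segment w u); rewrite leq_add2l.
apply: leq_trans (leq_mul (leqnn (b - a)) le).
by rewrite mulnDr leq_add2l leq_pmull.
Qed.

End Sums.
End Pair.
End Improvement.

(** * Iterated compression *)

Lemma nonincreasing_stationary (f : nat -> nat) :
  (forall s, f s.+1 <= f s) -> exists N, forall s, N <= s -> f s = f N.
Proof.
move=> dec; have mono s t : s <= t -> f t <= f s.
  elim: t => [|t IH]; first by rewrite leqn0 => /eqP ->.
  by rewrite leq_eqVlt => /orP[/eqP -> //|/IH]; apply: leq_trans (dec t).
move: {2}(f 0) (leqnn (f 0)) => v.
suff main N : f N <= v -> exists M, forall s, M <= s -> f s = f M by apply: main.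
elim: v N => [|v IH] N.
  rewrite leqn0 => /eqP fN; exists N => s /mono; rewrite fN leqn0 => /eqP //.
move=> fN; have [[M [NM ltM]]|nM] := boolp.pselect (exists M, N <= M /\ f M < f N).
  by apply: (IH M); rewrite -ltnS (leq_trans ltM).
exists N => s Ns; apply/eqP; rewrite eqn_leq mono //= leqNgt; apply/negP => lt.
by apply: nM; exists s.
Qed.

Section Limit.
Variables (k : fieldType) (n : nat) (e : 'I_n -> option nat).
Implicit Types (U V W : pred 'X_{1..n}) (m mu nu : 'X_{1..n}) (a b q : 'I_n).
Hypothesis e_neq0 : forall b, e b != Some 0.
Hypothesis e_mono : forall a b t, a < b -> below (e a) t -> below (e b) t.

Lemma mdeg_mnm_ind (C : {set 'I_n}) : mdeg (mnm_ind C) = #|C|.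
Proof.
rewrite mdegE -sum1_card [RHS]big_mkcond; apply: eq_bigr => q _.
by rewrite mnmE; case: (q \in C).
Qed.

(** Homological degree i and degree j involve only monomials of degree j - i. Hence every inequality
    for the limit can be read off at a finite stage, although no stage serves all degrees. *)
Lemma eq_faces U V i mu :
  (forall m, mdeg m = mdeg mu - i -> U m = V m) -> faces U i mu = faces V i mu.
Proof.
move=> E; apply/setP => C; rewrite !inE; case: eqP => //= Ci.
case: (boolP (mnm_ind C <= mu)%MM) => //= le; apply: E.
by rewrite -[in RHS](submK le) mdegD mdeg_mnm_ind Ci addnK.
Qed.

Lemma eq_rank_sum U V i j :
  (forall m, mdeg m = j - i -> U m = V m) -> rank_sum k U i j = rank_sum k V i j.
Proof.
move=> E; apply: eq_big_seq => mu; rewrite mem_monos => /eqP mj.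
by rewrite (@eq_faces U V) // mj.
Qed.

Lemma eq_face_sum U V i j :
  (forall m, mdeg m = j - i -> U m = V m) -> face_sum U i j = face_sum V i j.
Proof.
move=> E; apply: eq_big_seq => mu; rewrite mem_monos => /eqP mj.
by rewrite (@eq_faces U V) // mj.
Qed.

Lemma eq_compression a b x U V m : a != b ->
  (forall m', mdeg m' = mdeg m -> U m' = V m') ->
  compression a b x U m = compression a b x V m.
Proof.
move=> ab E; rewrite /compression /fibre_count; congr (_ || (_ < _)).
apply: eq_bigr => t _; congr (nat_of_bool (_ && _)); apply: E.
have tm : t <= m a + m b by rewrite -ltnS.
by have := mdeg_setab m (m a + m b - t) t ab; rewrite subnK // => /addIn.
Qed.

Definition admissible U := upclosed U /\ contains_powers e U.

(** The last clause turns stationary weights into stationary ideals, degree by degree. *)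
Definition improves U V :=
  [/\ admissible V,
      forall i j, rank_sum k U i j <= rank_sum k V i j,
      forall i j, face_sum V i j = face_sum U i j,
      forall j, weight V j <= weight U j
    & forall j, weight V j = weight U j -> forall m, mdeg m = j -> V m = U m].

Lemma improves_refl U : admissible U -> improves U U.
Proof. by move=> gU; split. Qed.

Lemma improves_trans V U W : improves U V -> improves V W -> improves U W.
Proof.
move=> [_ r1 f1 w1 e1] [gW r2 f2 w2 e2]; split=> // [i j|i j|j|j E m mj].
- exact: leq_trans (r1 i j) (r2 i j).
- by rewrite f2.
- exact: leq_trans (w2 j) (w1 j).
- have E2 : weight W j = weight V j.
    by apply/eqP; rewrite eqn_leq w2 E w1.
  by rewrite (e2 j E2 m mj) (e1 j _ m mj) // -E2.
Qed.

Lemma improves_compression a b U : a < b -> admissible U ->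
  improves U (compression a b (e b) U).
Proof.
move=> ab [cU PU].
have eab t : below (e a) t -> below (e b) t by apply: e_mono.
have wc j := weight_compression ab (e_neq0 b) j PU.
split=> [|i j|i j|j|j E m mj].
- split; first exact: (compression_upclosed ab (e_neq0 b) eab PU cU).
  exact: (compression_contains ab (e_neq0 b) PU).
- exact: (rank_sum_compression k ab (e_neq0 b) eab j PU i).
- exact: (face_sum_compression ab (e_neq0 b) j PU i).
- exact: leq_trans (leq_addr _ _) (wc j).
- have := wc j; rewrite E -[leqRHS]addn0 leq_add2l; case: allP => // h _.
  by apply/eqP/h; rewrite mem_monos mj.
Qed.

Definition compress_all (l : seq ('I_n * 'I_n)) U :=
  foldr (fun p V => compression p.1 p.2 (e p.2) V) U l.

(** No compression raises the weight, so if a whole pass keeps it in degree j, each step of the pass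
    was trivial there and U itself is fixed by every pair. *)
Lemma improves_compress_all (l : seq ('I_n * 'I_n)) U :
  all (fun p : 'I_n * 'I_n => p.1 < p.2) l -> admissible U ->
  improves U (compress_all l U) /\
  forall j, weight (compress_all l U) j = weight U j ->
    forall p, p \in l -> forall m, mdeg m = j ->
    compression p.1 p.2 (e p.2) U m = U m.
Proof.
move=> + gU; elim: l => [|p l IH] /=; first by split; [exact: improves_refl|].
move=> /andP[ltp /IH[impl fixl]].
have [gl rl fl wl el] := impl.
have imp := improves_compression ltp gl; split; first exact: improves_trans imp.
move=> j E; have [_ _ _ wp ep] := imp.
have E1 : weight (compress_all l U) j = weight U j.
  by apply/eqP; rewrite eqn_leq wl -E wp.
move=> q; rewrite inE => /orP[/eqP -> m mj|]; last exact: fixl.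
rewrite -(el j E1 m mj) -(ep j _ m mj) ?E ?E1 //.
apply: eq_compression => [|m' Em']; last by rewrite (el j E1) // Em'.
by rewrite -(inj_eq val_inj) ltn_eqF.
Qed.

Definition all_pairs : seq ('I_n * 'I_n) :=
  [seq p : 'I_n * 'I_n <- enum {: 'I_n * 'I_n} | p.1 < p.2].

Theorem compression_limit U : admissible U ->
  exists V, [/\ admissible V,
    forall i j, rank_sum k U i j <= rank_sum k V i j,
    forall i j, face_sum V i j = face_sum U i j
  & forall a b, a < b -> compression a b (e b) V =1 V].
Proof.
move=> gU; pose W s := iter s (compress_all all_pairs) U.
have apl : all (fun p : 'I_n * 'I_n => p.1 < p.2) all_pairs by exact: filter_all.
have gW s : admissible (W s).
  by elim: s => [//|s gs]; have [[]] := improves_compress_all apl gs.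
have impS s := improves_compress_all apl (gW s).
have imp s : improves U (W s).
  elim: s => [|s IH]; first exact: improves_refl.
  exact: improves_trans IH (impS s).1.
have stat j : exists N, forall s, N <= s -> weight (W s) j = weight (W N) j.
  apply: nonincreasing_stationary => s.
  by have [[_ _ _ + _] _] := impS s; apply.
have statm j : exists N, forall s m, N <= s -> mdeg m = j -> W s m = W N m.
  have [N hN] := stat j; exists N => s m Ns mj.
  elim: s Ns => [|s IH]; first by rewrite leqn0 => /eqP ->.
  rewrite leq_eqVlt => /orP[/eqP -> //|]; rewrite ltnS => Ns; rewrite -(IH Ns).
  have [[_ _ _ _ h] _] := impS s; apply: (h j) => //.
  by rewrite -/(W s.+1) (hN s.+1) ?(hN s) ?leqW.
(* The limit consists of the monomials that are eventually always present; in each degree it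
   coincides with all late stages. *)
pose V m := boolp.asbool (exists N, forall s, N <= s -> W s m).
have VW j : exists N, forall s m, N <= s -> mdeg m = j -> V m = W s m.
  have [N hN] := statm j; exists N => s m Ns mj.
  rewrite (hN s m) //; apply/boolp.asboolP/idP => [[M hM]|WN]; last first.
    by exists N => t Nt; rewrite (hN t m).
  by rewrite -(hN (maxn N M) m) ?leq_maxl ?hM ?leq_maxr.
exists V; split.
- split=> [m q|q m nb].
    have [N1 h1] := VW (mdeg m); have [N2 h2] := VW (mdeg (m + U_(q))%MM).
    rewrite (h1 (maxn N1 N2)) ?leq_maxl // (h2 (maxn N1 N2)) ?leq_maxr //.
    exact: (gW _).1.
  have [N h] := VW (mdeg m); rewrite (h N) //; exact: (gW _).2 nb.
- move=> i j; have [N h] := VW (j - i).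
  rewrite (@eq_rank_sum V (W N)); last by move=> m mj; apply: h.
  by have [_ + _ _ _] := imp N; apply.
- move=> i j; have [N h] := VW (j - i).
  rewrite (@eq_face_sum V (W N)); last by move=> m mj; apply: h.
  by have [_ _ + _ _] := imp N; apply.
move=> a b ab m; have [N1 h1] := VW (mdeg m); have [N2 h2] := stat (mdeg m).
pose N := maxn N1 N2.
have VN m' : mdeg m' = mdeg m -> V m' = W N m'.
  by move=> E; apply: h1; rewrite ?leq_maxl.
have nab : a != b by rewrite -(inj_eq val_inj) ltn_eqF.
rewrite (eq_compression _ nab VN) VN //.
have [_ fx] := impS N; apply: (fx (mdeg m) _ (a, b)) => //; last first.
  by rewrite mem_filter mem_enum ab.
by rewrite -/(W N.+1) (h2 N.+1) ?(h2 N) ?leqW ?leq_maxr.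
Qed.

Lemma upclosed_le U m0 m : upclosed U -> (m0 <= m)%MM -> U m0 -> U m.
Proof.
move=> cU /submK <-; rewrite addmC; move: (m - m0)%MM => d U0.
rewrite [d]multinomUE_id; elim/big_rec: _ => [|q x _ Ux]; first by rewrite addm0.
rewrite addmA [(m0 + _)%MM]addmC -addmA; elim: (d q) => [|c IH];
  first by rewrite mulm0n add0m.
by rewrite mulmS -addmA addmC; apply: cU.
Qed.

(** Below e_b a fixed set is an initial segment of each fibre, and the exchanged monomial has the
    same fibre count with a smaller x_b-exponent. *)
Lemma compression_exchange a b V m : a < b -> compression a b (e b) V =1 V ->
  V m -> below (e b) (m b) -> 0 < m b ->
  V (setab a b m (m a).+1 (m b).-1).
Proof.
move=> ltab fx; have ab : a != b by rewrite -(inj_eq val_inj) ltn_eqF.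
rewrite -[V (setab _ _ _ _ _)]fx -[V m]fx /compression setab_b // => + bb b0.
rewrite bb /= /fibre_count setab_a setab_b //.
have -> : (m a).+1 + (m b).-1 = m a + m b by lia.
move=> lt; apply/orP; right; apply: leq_trans (_ : m b <= _).
  by rewrite prednK.
apply: ltnW; apply: leq_trans lt _; apply: leq_sum => t _.
by rewrite setab_setab.
Qed.

(* Take the first b where m0 exceeds m; the partial sum up to b gives an a < b
   where m exceeds m0, and the exchange x_b -> x_a moves m0 towards m. As m is
   not a multiple of a power, neither is the exchanged monomial. *)
Lemma dominated_mem V m0 m : admissible V ->
  (forall a b, a < b -> compression a b (e b) V =1 V) ->
  V m0 -> (forall q, below (e q) (m0 q)) ->
  (forall p : 'I_n, \sum_(q < n | q <= p) m0 q <= \sum_(q < n | q <= p) m q) ->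
  V m.
Proof.
move=> [cV PV] fx.
have [/existsP[q nq] *|] := boolP [exists q, ~~ below (e q) (m q)].
  exact: PV nq.
rewrite negb_exists => /forallP bm.
have {}bm q : below (e q) (m q) by have := bm q; rewrite negbK.
move: {2}(\sum_q (m0 q - m q)) (leqnn (\sum_q (m0 q - m q))) => s.
elim: s m0 => [|s IH] m0 les Vm0 bm0 dom.
  apply: (upclosed_le cV _ Vm0); apply/mnm_lepP => q.
  by move: les; rewrite leqn0 sum_nat_eq0 => /forallP /(_ q); rewrite subn_eq0.
have [le|] := boolP (m0 <= m)%MM; first exact: (upclosed_le cV le Vm0).
rewrite negb_forall => /existsP[b0]; rewrite -ltnNge => ltb0.
case: (@arg_minnP _ b0 (fun q => m q < m0 q) (fun q : 'I_n => nat_of_ord q) ltb0).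
move=> b ltb minb.
have leb q : q < b -> m0 q <= m q.
  by move=> qb; rewrite leqNgt; apply: contraL qb => /minb; rewrite -leqNgt.
have sumb (p : 'I_n) (F : 'I_n -> nat) : b <= p ->
    \sum_(q < n | q <= p) F q = F b + \sum_(q < n | (q <= p) && (q != b)) F q.
  by move=> bp; rewrite (bigD1 b).
have [a ltab lta] : exists2 a : 'I_n, a < b & m0 a < m a.
  have [/existsP[a /andP[h1 h2]]|] := boolP [exists a : 'I_n, (a < b) && (m0 a < m a)].
    by exists a.
  rewrite negb_exists => /forallP h.
  exfalso; have := dom b; apply/negP; rewrite !sumb // -ltnNge -addSn leq_add //.
  apply: leq_sum => q /andP[qb qnb].
  have {qnb}qb : q < b by rewrite ltn_neqAle qb andbT.
  by have := h q; rewrite qb /= -leqNgt.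
have ab : a != b by rewrite -(inj_eq val_inj) ltn_eqF.
pose m1 := setab a b m0 (m0 a).+1 (m0 b).-1.
have b0' : 0 < m0 b by apply: leq_ltn_trans ltb.
have m1q q : q != a -> q != b -> m1 q = m0 q.
  by move=> qa qb; rewrite mnmE (negPf qa) (negPf qb).
apply: (IH m1).
- rewrite -ltnS; apply: leq_trans les.
  rewrite (bigD1 b) //= [in X in _ < X](bigD1 b) //= -addSn leq_add //.
    by rewrite /m1 setab_b //; lia.
  apply: leq_sum => q qb; have [->|qa] := eqVneq q a; last by rewrite m1q.
  by rewrite /m1 setab_a; lia.
- exact: compression_exchange (fx _ _ ltab) Vm0 (bm0 b) b0'.
- move=> q; have [->|qa] := eqVneq q a; first by rewrite /m1 setab_a (below_le lta).
  have [->|qb] := eqVneq q b; last by rewrite m1q.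
  by rewrite /m1 setab_b // (below_le (leq_pred _) (bm0 b)).
move=> p; have [bp|pb] := leqP b p.
  apply: leq_trans (dom p); rewrite !sumb //.
  have ap : (a <= p) && (a != b) by rewrite ab (leq_trans (ltnW ltab)).
  rewrite (bigD1 a) //= [in leqRHS](bigD1 a) //= /m1 setab_a setab_b //.
  rewrite (eq_bigr m0) => [|q /andP[/andP[_ qb] qa]]; last exact: m1q.
  by rewrite !addnA leq_add2r; lia.
apply: leq_sum => q qp; have qb : q < b by apply: leq_ltn_trans pb.
have [->|qa] := eqVneq q a; first by rewrite /m1 setab_a.
by rewrite m1q ?leb // -(inj_eq val_inj) ltn_eqF.
Qed.

End Limit.

From mathcomp Require Import boolp classical_sets.

Local Open Scope ring_scope.

(** * Betti numbers and Hilbert functions *)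

Section GradedDimension.
Variables (k : fieldType) (M : lmodType k).
Implicit Types Z W : set M.

Lemma is_dim_fin Z W (T : finType) (v : T -> M) :
  (forall t, Z (v t)) ->
  (forall c : T -> k, W (\sum_t c t *: v t) -> forall t, c t = 0) ->
  (forall z, Z z -> exists c : T -> k, W (z - \sum_t c t *: v t)) ->
  is_dim Z W #|T|.
Proof.
move=> vZ vfree vspan.
have re (c : T -> k) : \sum_t c t *: v t =
    \sum_(i < #|T|) c (enum_val i) *: v (enum_val i).
  by rewrite (reindex (@enum_val T T)) //; apply/onW_bij/enum_val_bij.
exists (fun i => v (enum_val i)); split=> [i|c Wc i|z /vspan[c Wc]].
- exact: vZ.
- rewrite -[i]enum_valK; apply: (vfree (fun t => c (enum_rank t))).
  by rewrite re; under eq_bigr do rewrite enum_valK.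
- by exists (fun i => c (enum_val i)); rewrite -re.
Qed.

Variables (V : vectType k) (I0 : finType).
Variables (phi : I0 -> {linear M -> V}) (psi : I0 -> {linear V -> M}).
Variables (Zv Bv : I0 -> {vspace V}).

(** Through [phi] and [psi] the quotient is a finite direct sum of the quotients of [Zv i] by
    [Bv i]; bases of complements of [Bv i] in [Zv i] together form a basis. This carries dimensions
    of spaces inside an infinite-dimensional module over to finite-dimensional pieces. *)
Lemma is_dim_graded Z W :
  (forall i, (Bv i <= Zv i)%VS) ->
  (forall i z, z \in Zv i -> Z (psi i z)) ->
  (forall z, Z z -> (forall i, phi i z \in Zv i) /\ z = \sum_i psi i (phi i z)) ->
  (forall i i' z, z \in Zv i -> phi i' (psi i z) = if i' == i then z else 0) ->
  (forall w i, W w -> phi i w \in Bv i) ->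
  (forall b : I0 -> V, (forall i, b i \in Bv i) -> W (\sum_i psi i (b i))) ->
  is_dim Z W (\sum_i (\dim (Zv i) - \dim (Bv i)))%N.
Proof.
move=> BZ psiZ decZ phipsi phiW psiW.
pose D i := (Zv i :\: Bv i)%VS.
have DZ i : (D i <= Zv i)%VS by exact: diffvSl.
have dimD i : \dim (D i) = (\dim (Zv i) - \dim (Bv i))%N.
  by rewrite -(dimv_cap_compl (Zv i) (Bv i)) (capv_idPr (BZ i)) addKn.
pose T := {i : I0 & 'I_(\dim (D i))}.
have -> : (\sum_i (\dim (Zv i) - \dim (Bv i)))%N = #|{: T}|.
  rewrite card_tagged sumnE big_map big_enum /=.
  by apply: eq_bigr => i _; rewrite card_ord dimD.
pose tg i (j : 'I_(\dim (D i))) : T := Tagged (fun i => 'I_(\dim (D i))) j.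
pose bas i (j : 'I_(\dim (D i))) := (vbasis (D i))`_j.
have basD i j : bas i j \in D i by apply: vbasis_mem; rewrite mem_nth ?size_tuple.
pose v (t : T) := psi (tag t) (bas _ (tagged t)).
have sumT (c : T -> k) : \sum_t c t *: v t =
    \sum_i psi i (\sum_(j < \dim (D i)) c (tg _ j) *: bas i j).
  under [RHS]eq_bigr do rewrite raddf_sum.
  rewrite (sig_big_dep xpredT (fun=> xpredT)
    (fun i j => psi i (c (tg _ j) *: bas i j))) /=.
  by apply: eq_big => // -[i j] _; rewrite linearZ.
have phis (u : I0 -> V) i : (forall i, u i \in Zv i) ->
    phi i (\sum_i psi i (u i)) = u i.
  move=> uZ; rewrite raddf_sum (bigD1 i) //= phipsi // eqxx big1 ?addr0 // => i' ne.
  by rewrite phipsi // eq_sym (negPf ne).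
have sumD i (c : 'I_(\dim (D i)) -> k) : \sum_(j < \dim (D i)) c j *: bas i j \in D i.
  by apply: memv_suml => j _; apply: memvZ.
apply: (is_dim_fin (v := v)) => [t|c Wc t|z Zz].
- by apply: psiZ; apply: subvP (DZ _) _ (basD _ _).
- have := phiW _ (tag t) Wc; rewrite sumT phis => [|i]; last first.
    exact: subvP (DZ i) _ (sumD _ _).
  move=> inB; have := conj (sumD (tag t) (fun j => c (tg _ j))) inB.
  move=> /andP; rewrite -memv_cap capv_diff memv0 => /eqP s0.
  have /freeP/(_ (fun j => c (tg _ j)) s0) := basis_free (vbasisP (D (tag t))).
  by move/(_ (tagged t)); case: (t).
have [phiZ zE] := decZ z Zz.
have /choice[b /= hb] : forall i, exists b : V, b \in Bv i /\
    exists c : 'I_(\dim (D i)) -> k, phi i z = \sum_j c j *: bas i j + b.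
  move=> i; have := phiZ i; rewrite -{1}(addv_diff_cap (Zv i) (Bv i)).
  case/memv_addP => x xD [y]; rewrite memv_cap => /andP[_ yB] E.
  exists y; split=> //; exists (fun j => coord (vbasis (D i)) j x).
  by rewrite E {1}(coord_vbasis xD).
pose c i := projT1 (cid (hb i).2).
have hc i : phi i z = \sum_j c i j *: bas i j + b i := projT2 (cid (hb i).2).
exists (fun t => c (tag t) (tagged t)).
rewrite sumT {1}zE -sumrB.
under eq_bigr => i _ do rewrite -raddfB [phi i z]hc addrC addKr.
by apply: psiW => i; have [] := hb i.
Qed.

End GradedDimension.

(** * Multigraded pieces of the Koszul complex *)

Section Multidegrees.
Variables (k : fieldType) (n : nat).
Local Notation S := {mpoly k[n]}.
Local Notation V := {ffun {set 'I_n} -> k^o}.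
Implicit Types (mu nu m : 'X_{1..n}) (C : {set 'I_n}) (U : pred 'X_{1..n}).

Definition monomial_span U : set S := [set f : S | forall m, m \in msupp f -> U m].

Section Fixed.
Variable i : nat.
Local Notation M := {ffun kgen n i -> S}.
Implicit Types (v : M) (u : V).

(** The coefficients of x^(mu - C) e_C, one scalar for each face C. *)
Definition mdeg_part mu v : V :=
  [ffun C : {set 'I_n} => if (mnm_ind C <= mu)%MM then (kext v C)@_(mu - mnm_ind C)
                else 0].

Definition mdeg_embed mu u : M :=
  [ffun c => if (mnm_ind (val c) <= mu)%MM
             then (u (val c) : k) *: 'X_[mu - mnm_ind (val c)] else 0].

Fact mdeg_part_is_linear mu : linear (mdeg_part mu).
Proof.
move=> a v w; apply/ffunP => C; rewrite !ffunE.
case: ifP => _; last by rewrite scaler0 addr0.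
rewrite /kext; case: insub => [c|]; last by rewrite !mcoeff0 scaler0 addr0.
by rewrite !ffunE mcoeffD mcoeffZ.
Qed.
HB.instance Definition _ mu :=
  GRing.isLinear.Build k M V _ (mdeg_part mu) (mdeg_part_is_linear mu).

Fact mdeg_embed_is_linear mu : linear (mdeg_embed mu).
Proof.
move=> a v w; apply/ffunP => c; rewrite !ffunE.
case: ifP => _; last by rewrite scaler0 addr0.
by rewrite scalerDl scalerA.
Qed.
HB.instance Definition _ mu :=
  GRing.isLinear.Build k V M _ (mdeg_embed mu) (mdeg_embed_is_linear mu).

Lemma mdeg_part_val mu v (c : kgen n i) :
  mdeg_part (mu + mnm_ind (val c))%MM v (val c) = (v c)@_mu.
Proof. by rewrite ffunE lem_addl addmK kext_val. Qed.

Lemma mdeg_part_inj v w : (forall mu, mdeg_part mu v = mdeg_part mu w) -> v = w.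
Proof.
move=> E; apply/ffunP => c; apply/mpolyP => m.
by rewrite -!mdeg_part_val E.
Qed.

Lemma mdeg_embedK mu nu u : u \in coords k (faces xpredT i mu) ->
  mdeg_part nu (mdeg_embed mu u) = if nu == mu then u else 0.
Proof.
move=> /coordsP h; apply/ffunP => C; rewrite ffunE.
have [Ci|Ci] := boolP (#|C| == i); last first.
  rewrite kext_card // mcoeff0 if_same; case: eqP => _; last by rewrite ffunE.
  by rewrite h // inE (negPf Ci).
rewrite -(val_ksub Ci) kext_val ffunE val_ksub; case: ifP => leC; last first.
  case: eqP => [E|_]; last by rewrite ffunE.
  by rewrite h // inE Ci -E leC.
case: eqVneq leC => [->|ne] leC.
  by rewrite leC mcoeffZ mcoeffX eqxx mulr1.
rewrite ffunE; case: ifP => leC'; last by rewrite mcoeff0.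
rewrite mcoeffZ mcoeffX; case: eqP => [E|_]; last by rewrite mulr0.
by case/eqP: ne; rewrite -(submK leC) -E submK.
Qed.

End Fixed.

(** Multiplication by x_q compensates the removal of q from the face, so in a fixed multidegree only
    the signs of the Koszul differential remain. *)
Lemma mdeg_part_diff i mu (w : {ffun kgen n i.+1 -> S}) :
  mdeg_part mu (free_map (@kdiff k n i) w) = bdy k xpredT (mdeg_part mu w).
Proof.
apply/ffunP => C; rewrite ffunE kext_free_map bdyE sum_ffunE.
case: ifP => leC; last first.
  rewrite big1 // => q _; rewrite !ffunE; case: ifP => // qC.
  rewrite ifF ?scaler0 //; apply: contraFF leC => /mnm_lepP le.
  by apply/mnm_lepP => r; apply: leq_trans (le r); rewrite !mnmE !inE;
    case: (r \in C); rewrite ?orbT.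
rewrite kdE [RHS](bigID (fun q => (q \notin C) && (0 < (mu - mnm_ind C)%MM q)%N)) /=.
rewrite [X in _ = _ + X]big1 ?addr0 => [|q nq].
  apply: eq_bigr => q /andP[qC q0]; rewrite !ffunE (negPf qC).
  have E : (mnm_ind (q |: C) = mnm_ind C + U_(q))%MM.
    apply/mnmP => r; rewrite !mnmE !inE eq_sym.
    by case: eqP => [<-|_]; rewrite ?(negPf qC) ?addn0.
  have le : (mnm_ind (q |: C) <= mu)%MM.
    rewrite E; apply/mnm_lepP => r; move/mnm_lepP/(_ r): leC.
    move: q0; rewrite !mnmE; case: eqP => [<-|_]; rewrite ?addn0 //; lia.
  rewrite le; congr (_ * mcoeff _ _); apply/mnmP => r.
  by rewrite E !mnmE subnDA.
rewrite !ffunE; case: ifPn => // qC; rewrite qC /= -leqNgt leqn0 in nq.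
rewrite ifF ?scaler0 //; apply/negP => /mnm_lepP /(_ q).
by move: nq; rewrite !mnmE setU11 (negPf qC) subn0 => /eqP ->.
Qed.

Lemma bdy_faces U i mu (u : V) : upclosed U ->
  u \in coords k (faces U i.+1 mu) -> bdy k xpredT u \in coords k (faces U i mu).
Proof.
move=> cU /coordsP h; apply/coordsP => C nC; rewrite bdyE sum_ffunE big1 // => q _.
rewrite ffunE; case: ifPn => // qC; rewrite h ?scaler0 //; apply: contra nC.
rewrite !inE cardsU1 qC add1n eqSS => /and3P[-> le Uq] /=.
have E : (mnm_ind (q |: C) = mnm_ind C + U_(q))%MM.
  apply/mnmP => r; rewrite !mnmE !inE eq_sym.
  by case: eqP => [<-|_]; rewrite ?(negPf qC) ?addn0.
have leC : (mnm_ind C <= mu)%MM by apply: lepm_trans le; rewrite E lem_addr.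
rewrite leC /=; have -> : (mu - mnm_ind C = mu - mnm_ind (q |: C) + U_(q))%MM.
  apply/mnmP => r; move/mnm_lepP/(_ r): le; rewrite E !mnmE; lia.
exact: cU.
Qed.

Lemma faces_predT U i mu : faces U i mu \subset faces xpredT i mu.
Proof. by apply/fintype.subsetP => C; rewrite !inE => /and3P[-> ->]. Qed.

Lemma coords_predT U i mu (u : V) : u \in coords k (faces U i mu) ->
  u \in coords k (faces xpredT i mu).
Proof. exact/subvP/coordsS/faces_predT. Qed.

Lemma tensor_compP U i j (v : {ffun kgen n i -> S}) :
  @tensor_comp k n (koszul k n) (monomial_span U) i j v <->
  forall c m, m \in msupp (v c) -> U m /\ (mdeg m + i = j)%N.
Proof.
rewrite /tensor_comp /=; split=> [h c m mc|h c].
  have [Uc hc] := h c; split; first exact: Uc.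
  move: hc; rewrite /shift_homog; case: leqP => [ij /dhomogP/(_ m mc) E|_ /eqP v0].
    by rewrite (E : mdeg m = j - i)%N subnK.
  by rewrite v0 msupp0 in mc.
split=> [m|]; first by case/h.
rewrite /shift_homog; case: leqP => [ij|ji].
  by apply/dhomogP => m /h[_ <-]; rewrite addnK.
apply/eqP/mpolyP => m; rewrite mcoeff0; apply/eqP; rewrite mcoeff_eq0.
by apply/negP => /h[_ E]; rewrite -E ltnNge leq_addl in ji.
Qed.

Lemma tensor_comp_mdeg_part U i j (v : {ffun kgen n i -> S}) mu :
  @tensor_comp k n (koszul k n) (monomial_span U) i j v ->
  mdeg_part mu v \in coords k (faces U i mu) /\
  (mdeg mu <> j -> mdeg_part mu v = 0).
Proof.
move=> /tensor_compP h.
have key C : mdeg_part mu v C != 0 -> C \in faces U i mu /\ mdeg mu = j.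
  rewrite ffunE; case: ifP => leC; last by rewrite eqxx.
  have [Ci|Ci] := boolP (#|C| == i); last by rewrite kext_card // mcoeff0 eqxx.
  rewrite -[C in kext v C](val_ksub Ci) kext_val -mcoeff_msupp => /h[Um E].
  rewrite inE Ci leC Um; split=> //.
  by rewrite -(submK leC) mdegD mdeg_mnm_ind (eqP Ci).
split=> [|ne].
  by apply/coordsP => C nC; apply/eqP; apply: contraNT nC => /key[].
apply/ffunP => C; rewrite [RHS]ffunE; apply/eqP.
by apply/negPn/negP => /key[_ /ne].
Qed.

Lemma mdeg_embed_tensor_comp U i j mu (u : V) : mdeg mu = j ->
  u \in coords k (faces U i mu) ->
  @tensor_comp k n (koszul k n) (monomial_span U) i j (mdeg_embed i mu u).
Proof.
move=> <- /coordsP h; apply/tensor_compP => c m; rewrite ffunE.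
case: ifP => leC; last by rewrite msupp0.
have [cf|/h ->] := boolP (val c \in faces U i mu); last by rewrite scale0r msupp0.
move=> /msuppZ_le; rewrite msuppX inE => /eqP ->.
move: cf; rewrite inE => /and3P[/eqP ci _ Um]; split=> //.
by rewrite -[in RHS](submK leC) mdegD mdeg_mnm_ind ci.
Qed.

Lemma tensor_compD U i j (v w : {ffun kgen n i -> S}) :
  @tensor_comp k n (koszul k n) (monomial_span U) i j v ->
  @tensor_comp k n (koszul k n) (monomial_span U) i j w ->
  @tensor_comp k n (koszul k n) (monomial_span U) i j (v + w).
Proof.
move=> /tensor_compP h1 /tensor_compP h2; apply/tensor_compP => c m.
rewrite ffunE => /msuppD_le; rewrite mem_cat => /orP[]; [exact: h1|exact: h2].
Qed.

Section Betti.
Variables (U : pred 'X_{1..n}) (i j : nat).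
Hypothesis cU : upclosed U.
Local Notation mono t := (nth 0%MM (monos n j) t).
Local Notation I0 := 'I_(size (monos n j)).

Let mdeg_mono (t : I0) : mdeg (mono t) = j.
Proof. by apply/eqP; rewrite -mem_monos mem_nth. Qed.

Let mono_inj (s t : I0) : (mono s == mono t) = (s == t).
Proof. by rewrite nth_uniq // monos_uniq. Qed.

Lemma tensor_comp_sum l (u : I0 -> V) :
  (forall t, u t \in coords k (faces U l (mono t))) ->
  @tensor_comp k n (koszul k n) (monomial_span U) l j
    (\sum_(t : I0) mdeg_embed l (mono t) (u t)).
Proof.
move=> hu; elim/big_ind: _ => [||t _]; last 1 first.
- exact: mdeg_embed_tensor_comp (mdeg_mono t) _.
- by apply/tensor_compP => c m; rewrite ffunE msupp0.
- exact: tensor_compD.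
Qed.

Lemma mdeg_part_sum l nu (u : I0 -> V) :
  (forall t, u t \in coords k (faces xpredT l (mono t))) ->
  mdeg_part nu (\sum_(t : I0) mdeg_embed l (mono t) (u t)) =
  \sum_(t : I0) if nu == mono t then u t else 0.
Proof.
by move=> hu; rewrite raddf_sum; apply: eq_bigr => t _; rewrite /= mdeg_embedK.
Qed.

Lemma mdeg_decomp l (v : {ffun kgen n l -> S}) :
  @tensor_comp k n (koszul k n) (monomial_span U) l j v ->
  v = \sum_(t < size (monos n j)) mdeg_embed l (mono t) (mdeg_part (mono t) v).
Proof.
move=> tv; apply: mdeg_part_inj => nu; rewrite mdeg_part_sum; last first.
  by move=> t; apply/coords_predT/(tensor_comp_mdeg_part _ tv).1.
have [nuj|nuj] := boolP (nu \in monos n j).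
  have lt : (index nu (monos n j) < size (monos n j))%N by rewrite index_mem.
  rewrite (bigD1 (Ordinal lt)) //= nth_index // eqxx big1 ?addr0 // => t ne.
  by rewrite -[nu in nu == _](nth_index 0%MM nuj) (mono_inj (Ordinal lt)) eq_sym
    (negPf ne).
rewrite (tensor_comp_mdeg_part _ tv).2; last first.
  by move=> E; rewrite mem_monos E eqxx in nuj.
rewrite big1 // => t _; case: eqP => // E.
by rewrite E mem_nth in nuj.
Qed.

Lemma tor_cyclesP l (v : {ffun kgen n l -> S}) :
  @tor_cycles k n (koszul k n) (monomial_span U) l j v <->
  @tensor_comp k n (koszul k n) (monomial_span U) l j v /\
  forall mu, bdy k xpredT (mdeg_part mu v) = 0.
Proof.
case: l v => [|l] v /=.
  (* In homological degree 0 there is no condition: the boundary reads values only at nonempty sets,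
     where such a vector vanishes. *)
  split=> [tv|[]//]; split=> // mu.
  have [/coordsP h _] := tensor_comp_mdeg_part mu tv.
  apply/ffunP => C; rewrite bdyE sum_ffunE big1 ?ffunE // => q _.
  by rewrite ffunE; case: ifP => // qC; rewrite h ?scaler0 // inE cardsU1 qC.
split=> -[tv dv]; split=> //; first move=> mu.
  by rewrite -mdeg_part_diff dv; apply: raddf0.
apply: mdeg_part_inj => mu; rewrite mdeg_part_diff dv; apply/esym; exact: raddf0.
Qed.

Let Zv (t : I0) : {vspace V} := (coords k (faces U i (mono t)) :&: lker (bdy k
  xpredT))%VS.
Let Bv (t : I0) : {vspace V} := (bdy k xpredT @: coords k (faces U i.+1 (mono t)))%VS.

Lemma is_dim_tor : is_dim (@tor_cycles k n (koszul k n) (monomial_span U) i j)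
  (@tor_boundaries k n (koszul k n) (monomial_span U) i j)
  (\sum_t (\dim (Zv t) - \dim (Bv t)))%N.
Proof.
have BZ t : (Bv t <= Zv t)%VS.
  apply/subvP => _ /memv_imgP[u uf ->].
  by rewrite memv_cap bdy_faces // (memv_ker (bdy k xpredT)) bdy_bdy eqxx.
have ZvP t u : u \in Zv t -> u \in coords k (faces U i (mono t)) /\ bdy k xpredT u = 0.
  by rewrite memv_cap (memv_ker (bdy k xpredT)) => /andP[-> /eqP ->].
pose phi (t : I0) : {linear {ffun kgen n i -> S} -> V} := mdeg_part (mono t).
pose psi (t : I0) : {linear V -> {ffun kgen n i -> S}} := mdeg_embed i (mono t).
refine (@is_dim_graded k _ V I0 phi psi Zv Bv _ _ BZ _ _ _ _ _).
- move=> t u /ZvP[uf du]; apply/tor_cyclesP; split=> [|mu].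
    exact: mdeg_embed_tensor_comp (mdeg_mono t) _.
  rewrite /psi /= mdeg_embedK; last exact: coords_predT uf.
  by case: eqP => _; rewrite ?raddf0.
- move=> v /tor_cyclesP[tv dv]; split=> [t|]; last exact: mdeg_decomp.
  rewrite memv_cap (tensor_comp_mdeg_part _ tv).1 (memv_ker (bdy k xpredT)).
  by rewrite /phi /= dv eqxx.
- move=> t t' u /ZvP[uf _]; rewrite /phi /psi /= mdeg_embedK ?mono_inj //.
  exact: coords_predT uf.
- move=> _ t [w tw <-]; rewrite /phi /= mdeg_part_diff; apply: memv_img.
  exact: (tensor_comp_mdeg_part _ tw).1.
move=> b bB.
have /choice[c hc] : forall t : I0, exists c : V, c \in coords k (faces U i.+1 (mono
  t)) /\
    b t = bdy k xpredT c.
  by move=> t; have /memv_imgP[c cf E] := bB t; exists c.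
exists (\sum_(t : I0) mdeg_embed i.+1 (mono t) (c t)).
  by apply: tensor_comp_sum => t; have [] := hc t.
apply: mdeg_part_inj => nu; rewrite /psi /= mdeg_part_diff !mdeg_part_sum.
- rewrite raddf_sum; apply: eq_bigr => t _ /=; have [_ ->] := hc t.
  by case: ifP => // _; rewrite raddf0.
- by move=> t; have /(subvP (BZ t))/ZvP[bf _] := bB t; apply: coords_predT bf.
- by move=> t; have [cf _] := hc t; apply: coords_predT cf.
Qed.

(** Rank and nullity express the dimension of the boundaries as the number of faces of size i + 1
    minus the dimension of the cycles among them. The additive form avoids truncated subtraction. *)
Lemma betti_rank_sum :
  (betti (monomial_span U) i j + face_sum U i.+1 j =
   rank_sum k U i j + rank_sum k U i.+1 j)%N.
Proof.
have big F : (\sum_(mu <- monos n j) F mu = \sum_(t : I0) F (mono t))%N.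
  by rewrite (big_nth 0%MM) big_mkord.
rewrite /betti /tor_dim (dimqE _ _ is_dim_tor).
- rewrite /face_sum /rank_sum !big -!big_split; apply: eq_bigr => t _ /=.
  rewrite /rank_cycles -(dim_coords k) /Zv /Bv.
  rewrite -(limg_ker_dim (bdy k xpredT) (coords k (faces U i.+1 _))).
  have le : (\dim (Bv t) <= \dim (Zv t))%N.
    apply: dimvS; apply/subvP => _ /memv_imgP[u uf ->].
    by rewrite memv_cap bdy_faces // (memv_ker (bdy k xpredT)) bdy_bdy eqxx.
  by rewrite addnCA addnC subnK // addnC.
- exists 0; [by apply/tensor_compP => c m; rewrite ffunE msupp0|].
  by apply: mdeg_part_inj => mu; rewrite mdeg_part_diff !raddf0.
move=> a _ _ [v tv <-] [w tw <-]; exists (a *: v + w).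
  apply: tensor_compD => //; apply/tensor_compP => c m; rewrite ffunE => /msuppZ_le.
  by move/tensor_compP: tv; apply.
by apply: mdeg_part_inj => mu; rewrite linearP /= !mdeg_part_diff !linearP.
Qed.

End Betti.

End Multidegrees.

(** * Hilbert functions as face counts *)

Section Hilbert.
Variables (k : fieldType) (n : nat).
Local Notation S := {mpoly k[n]}.
Implicit Types (m : 'X_{1..n}) (U : pred 'X_{1..n}).

Definition coef_at m (f : S) : k^o := f@_m.
Definition monomial_at m (c : k^o) : S := (c : k) *: 'X_[m].

Fact coef_at_is_linear m : linear (coef_at m).
Proof. by move=> a f g; rewrite /coef_at mcoeffD mcoeffZ. Qed.
HB.instance Definition _ m :=
  GRing.isLinear.Build k S k^o _ (coef_at m) (coef_at_is_linear m).

Fact monomial_at_is_linear m : linear (monomial_at m).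
Proof. by move=> a f g; rewrite /monomial_at scalerDl scalerA. Qed.
HB.instance Definition _ m :=
  GRing.isLinear.Build k k^o S _ (monomial_at m) (monomial_at_is_linear m).

(** The only face of size 0 is the empty one, so preservation of the Hilbert function is the case i
    = 0 of preservation of face counts. *)
Lemma hilbert_face_sum U d : hilbert (@monomial_span k n U) d = face_sum U 0 d.
Proof.
pose I0 := 'I_(size (monos n d)); pose mono (t : I0) := nth 0%MM (monos n d) t.
have mono_deg t : mdeg (mono t) = d by apply/eqP; rewrite -mem_monos mem_nth.
have mono_inj s t : (mono s == mono t) = (s == t) by rewrite nth_uniq // monos_uniq.
pose Zv (t : I0) : {vspace k^o} := if U (mono t) then fullv else 0%VS.
have -> : face_sum U 0 d = (\sum_t (\dim (Zv t) - \dim (0%VS : {vspace k^o})))%N.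
  rewrite /face_sum (big_nth 0%MM) big_mkord; apply: eq_bigr => t _.
  rewrite dimv0 subn0 /Zv -/(mono t).
  have E : mnm_ind (@finset.set0 'I_n) = 0%MM by apply/mnmP => q; rewrite !mnmE inE.
  have -> : faces U 0 (mono t) = if U (mono t) then [set finset.set0]%SET else
    finset.set0.
    apply/setP => C; rewrite inE cards_eq0; case: eqP => [->|nC] /=.
      rewrite E subm0 (_ : (0 <= _)%MM); last by apply/mnm_lepP => q; rewrite mnm0E.
      by case: (U _); rewrite inE ?eqxx.
    by case: (U _); rewrite !inE //; apply/esym/negbTE/eqP.
  by case: (U _); rewrite ?cards1 ?cards0 ?dimv0 // dimvf.
rewrite /hilbert; apply: dimqE => //.
  by move=> a u v /= -> ->; rewrite scaler0 addr0.
pose phi (t : I0) : {linear S -> k^o} := coef_at (mono t).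
pose psi (t : I0) : {linear k^o -> S} := monomial_at (mono t).
refine (@is_dim_graded k _ _ I0 phi psi Zv (fun=> 0%VS) _ _ _ _ _ _ _ _).
- by move=> t; apply: sub0v.
- move=> t z; rewrite /Zv; case: ifP => [Ut _|_]; last first.
    rewrite memv0 => /eqP ->; rewrite raddf0; split=> [m|]; first by rewrite msupp0.
    exact: rpred0.
  split=> [m /msuppZ_le|]; first by rewrite msuppX inE => /eqP ->.
  by apply: rpredZ; rewrite dhomogX /= mono_deg.
- move=> f [Uf /dhomogP hf]; split=> [t|].
    rewrite /Zv; case: ifP => Ut; first exact: memvf.
    rewrite memv0; apply/eqP; apply: memN_msupp_eq0.
    by apply: contraFN Ut; apply: Uf.
  apply/mpolyP => m; rewrite raddf_sum /=.
  have [md|md] := boolP (mdeg m == d); last first.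
    rewrite big1 => [|t _].
      apply: memN_msupp_eq0; apply: contra md => /hf E; apply/eqP; exact: E.
    rewrite mcoeffZ mcoeffX; case: eqP => [E|_]; last by rewrite mulr0.
    by rewrite -E mono_deg eqxx in md.
  have mm : m \in monos n d by rewrite mem_monos.
  have lt : (index m (monos n d) < size (monos n d))%N by rewrite index_mem.
  have Em : mono (Ordinal lt) = m by rewrite /mono nth_index.
  rewrite (bigD1 (Ordinal lt)) //= big1 => [|t ne]; rewrite mcoeffZ mcoeffX.
    by rewrite Em eqxx mulr1 addr0.
  by rewrite -Em mono_inj (negPf ne) mulr0.
- move=> t t' z _; rewrite /phi /psi /= /coef_at mcoeffZ mcoeffX mono_inj eq_sym.
  by case: eqP => _; rewrite ?mulr1 ?mulr0.
- by move=> w t /= ->; rewrite raddf0 mem0v.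
move=> b hb /=; rewrite big1 // => t _.
by have := hb t; rewrite memv0 => /eqP ->; rewrite raddf0.
Qed.

End Hilbert.

Local Open Scope classical_set_scope.

(** * Monomial ideals as spans of upward closed sets *)

Section MonomialIdeals.
Variables (k : fieldType) (n : nat).
Local Notation S := {mpoly k[n]}.
Implicit Types (m a : 'X_{1..n}) (U : pred 'X_{1..n}).

Lemma monomial_spanD U (f g : S) :
  @monomial_span k n U f -> @monomial_span k n U g -> @monomial_span k n U (f + g).
Proof.
by move=> Uf Ug m /msuppD_le; rewrite mem_cat => /orP[/Uf|/Ug].
Qed.

Lemma monomial_span_sum U (I : Type) (r : seq I) (Q : pred I) (F : I -> S) :
  (forall i, Q i -> @monomial_span k n U (F i)) ->
  @monomial_span k n U (\sum_(i <- r | Q i) F i).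
Proof.
move=> h; elim/big_ind: _ => // [m|f g]; first by rewrite msupp0.
exact: monomial_spanD.
Qed.

Lemma monomial_spanX U m : @monomial_span k n U 'X_[m] <-> U m.
Proof.
split=> [|Um m']; first by apply; rewrite msuppX inE.
by rewrite msuppX inE => /eqP ->.
Qed.

Lemma monomial_spanS U U' : (forall m, U m -> U' m) ->
  @monomial_span k n U `<=` @monomial_span k n U'.
Proof. by move=> h f Uf m /Uf/h. Qed.

Definition multiples (A : set 'X_{1..n}) : pred 'X_{1..n} :=
  fun m => `[< exists2 a, A a & (a <= m)%MM >].

Lemma multiples_upclosed A : upclosed (multiples A).
Proof.
move=> m q /asboolP[a Aa am]; apply/asboolP; exists a => //.
exact: lepm_trans am (lem_addr _ _).
Qed.

(** Zero generators are allowed because an infinite exponent contributes the generator 0 to P. *)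
Lemma ideal_gen_span (G : set S) (A : set 'X_{1..n}) :
  (forall g, G g -> g = 0 \/ exists2 a, A a & g = 'X_[a]) ->
  (forall a, A a -> G 'X_[a]) ->
  ideal_gen G = @monomial_span k n (multiples A).
Proof.
move=> GA AG; apply/seteqP; split=> f.
  move=> [r [c [g [Gg ->]]]]; apply: monomial_span_sum => i _ m.
  case: (GA _ (Gg i)) => [->|[a Aa ->]]; first by rewrite mulr0 msupp0.
  move=> /msuppM_le /allpairsP[[m1 m2] /= [_ + ->]].
  rewrite msuppX inE => /eqP ->; apply/asboolP; exists a => //; exact: lem_addl.
move=> Uf.
have ex (i : 'I_(size (msupp f))) : exists a, A a /\ (a <= nth 0%MM (msupp f) i)%MM.
  by have /Uf/asboolP[a Aa le] := mem_nth 0%MM (ltn_ord i); exists a.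
have [a ha] := choice ex.
pose mo (i : 'I_(size (msupp f))) := nth 0%MM (msupp f) i.
exists (size (msupp f)), (fun i => f@_(mo i) *: 'X_[mo i - a i]), (fun i => 'X_[a i]).
split=> [i|]; first by apply: AG; have [] := ha i.
rewrite {1}(mpolyE f) (big_nth 0%MM) big_mkord; apply: eq_bigr => i _.
by rewrite -scalerAl -mpolyXD submK //; have [] := ha i.
Qed.

Lemma monomial_idealP (J : set S) : monomial_ideal J ->
  exists U, upclosed U /\ J = @monomial_span k n U.
Proof.
move=> [A ->]; exists (multiples A); split; first exact: multiples_upclosed.
apply: ideal_gen_span => [_ [a Aa <-]|a Aa]; [by right; exists a | by exists a].
Qed.

Lemma monomial_ideal_span U : upclosed U -> monomial_ideal (@monomial_span k n U).
Proof.
move=> cU; exists [set m | U m].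
rewrite (@ideal_gen_span _ [set m | U m]) => [|_ [a Aa <-]|a Aa].
- congr monomial_span; apply/funext => m; apply/idP/asboolP => [Um|[a Ua am]].
    by exists m => //; apply: lepm_refl.
  exact: upclosed_le am Ua.
- by right; exists a.
- by exists a.
Qed.

Definition powers_multiples (e : 'I_n -> option nat) : pred 'X_{1..n} :=
  fun m => [exists q, ~~ below (e q) (m q)].

Lemma pure_powers_span e :
  pure_powers_ideal k e = @monomial_span k n (powers_multiples e).
Proof.
rewrite /pure_powers_ideal (@ideal_gen_span _
  [set m | exists q d, e q = Some d /\ m = (U_(q) *+ d)%MM]).
- congr monomial_span; apply/funext => m; apply/asboolP/existsP.
    move=> [_ [q [d [eq ->]]] /mnm_lepP/(_ q)].
    by rewrite mulmnE mnm1E eqxx mul1n => dm; exists q; rewrite eq /= -leqNgt.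
  move=> [q]; case eq: (e q) => [d|] //=; rewrite -leqNgt => dm.
  exists (U_(q) *+ d)%MM; first by exists q, d.
  by apply/mnm_lepP => r; rewrite mulmnE mnm1E; case: eqP => [<-|_]; rewrite ?mul1n.
- move=> _ [q _ <-]; rewrite /pure_power; case eq: (e q) => [d|]; last by left.
  by right; exists (U_(q) *+ d)%MM; [exists q, d|rewrite mpolyXn].
- by move=> _ [q [d [eq ->]]]; exists q => //; rewrite /pure_power eq mpolyXn.
Qed.

End MonomialIdeals.

(** * Borel-plus-P ideals *)

Section BorelPart.
Variables (k : fieldType) (n : nat) (e : 'I_n -> option nat).
Local Notation S := {mpoly k[n]}.
Implicit Types (m : 'X_{1..n}) (V : pred 'X_{1..n}).

(** The smallest Borel ideal containing the monomials of V outside P, described by partial sums of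
    exponents: exchanges x_j -> x_i with i < j and multiplications only increase these sums. *)
Definition dominator V : pred 'X_{1..n} := fun m =>
  `[< exists m0, [/\ V m0, forall q, below (e q) (m0 q) &
     forall p : 'I_n, (\sum_(q < n | q <= p) m0 q <= \sum_(q < n | q <= p) m q)%N] >].

Lemma partial_sum_add m (j p : 'I_n) :
  (\sum_(q < n | q <= p) (m + U_(j))%MM q = \sum_(q < n | q <= p) m q + (j <= p))%N.
Proof.
under eq_bigr do rewrite mnmDE mnm1E.
rewrite big_split /=; congr (_ + _)%N; case: leqP => jp.
  rewrite (bigD1 j) //= eqxx big1 ?addn0 // => q /andP[_ /negPf].
  by rewrite eq_sym => ->.
by rewrite big1 // => q qp; case: eqP => // E; rewrite -E leqNgt jp in qp.
Qed.

Lemma dominator_upclosed V : upclosed (dominator V).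
Proof.
move=> m q /asboolP[m0 [Vm0 bm0 dom]]; apply/asboolP; exists m0; split=> // p.
by rewrite partial_sum_add (leq_trans (dom p)) ?leq_addr.
Qed.

Lemma borel_dominator V : borel (@monomial_span k n (dominator V)).
Proof.
split; first exact/monomial_ideal_span/dominator_upclosed.
move=> m i j ij; rewrite -!mpolyXD !monomial_spanX => /asboolP[m0 [Vm0 bm0 dom]].
apply/asboolP; exists m0; split=> // p; apply: leq_trans (dom p) _.
rewrite !partial_sum_add leq_add2l; case: (leqP j p) => // jp.
by rewrite (leq_trans (ltnW ij)).
Qed.

Lemma borel_plus_span V : admissible e V ->
  (forall a b : 'I_n, (a < b)%N -> compression a b (e b) V =1 V) ->
  borel_plus (pure_powers_ideal k e) (@monomial_span k n V).
Proof.
move=> gV fx; rewrite pure_powers_span.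
have PV m : powers_multiples e m -> V m.
  by move=> /existsP[q]; apply: gV.2.
have DV m : dominator V m -> V m.
  by move=> /asboolP[m0 [Vm0 bm0 dom]]; apply: (dominated_mem gV fx Vm0 bm0 dom).
split; first exact: monomial_spanS.
exists (monomial_span (dominator V)); split; first exact: borel_dominator.
apply/seteqP; split=> [f Vf|_ [f Df [g Pg <-]]]; last first.
  by apply: monomial_spanD;
    [apply: monomial_spanS DV _ Df|apply: monomial_spanS PV _ Pg].
have part (Q : pred 'X_{1..n}) (W : pred 'X_{1..n}) :
    (forall m, V m -> Q m -> W m) ->
    @monomial_span k n W (\sum_(m <- msupp f | Q m) f@_m *: 'X_[m]).
  move=> QW; rewrite big_seq_cond; apply: monomial_span_sum => m /andP[mf Qm] m'.
  by move=> /msuppZ_le; rewrite msuppX inE => /eqP ->; apply: QW => //; apply: Vf.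
exists (\sum_(m <- msupp f | dominator V m) f@_m *: 'X_[m]); first exact: part.
exists (\sum_(m <- msupp f | ~~ dominator V m) f@_m *: 'X_[m]).
  (* A monomial of V outside P dominates itself, so what the Borel part misses lies in P. *)
  apply: part => m Vm; apply: contraR => nP; apply/asboolP; exists m; split=> // q.
  by apply: contraR nP => nb; apply/existsP; exists q.
by rewrite [RHS]mpolyE [RHS](bigID (dominator V)) /=.
Qed.

End BorelPart.

Theorem proposition8p7 (k : fieldType) (n : nat) (e : 'I_n -> option nat)
    (e_ge2 : forall i : 'I_n, le_exp (Some 2%N) (e i))
    (e_mono : forall i j : 'I_n, (i <= j)%N -> le_exp (e i) (e j))
    (I : set {mpoly k[n]}) (I_monomial : monomial_ideal I)
    (P_sub_I : pure_powers_ideal k e `<=` I) :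
  exists B : set {mpoly k[n]},
    [/\ borel_plus (pure_powers_ideal k e) B,
        forall d : nat, hilbert B d = hilbert I d
      & forall i j : nat, (betti I i j <= betti B i j)%N].
Proof.
have [U [cU IE]] := monomial_idealP I_monomial.
have gU : admissible e U.
  split=> // q m nb; apply/(monomial_spanX k U m); rewrite -IE; apply: P_sub_I.
  by rewrite pure_powers_span; apply/monomial_spanX/existsP; exists q.
have e_neq0 b : e b != Some 0%N by have := e_ge2 b; case: (e b) => [[]|].
have below_mono (a b : 'I_n) t : (a < b)%N -> below (e a) t -> below (e b) t.
  move=> /ltnW/e_mono; case: (e a) (e b) => [x|] [y|] //= xy tx.
  exact: leq_trans xy.
have [V [gV rank_le face_eq fx]] := compression_limit k e_neq0 below_mono gU.
exists (monomial_span V); split=> [|d|i j].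
- exact: borel_plus_span.
- by rewrite IE !hilbert_face_sum.
(* The face counts in the two identities agree, so Betti numbers compare as the sums of cycle
   dimensions in homological degrees i and i + 1. *)
have EU := betti_rank_sum k i j cU; have EV := betti_rank_sum k i j gV.1.
by rewrite IE -(leq_add2r (face_sum U i.+1 j)) EU -face_eq EV leq_add.
Qed.
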